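(* Let $d\ge 1$ be an integer and $\beta\in(0,1]$. Let $Z=(Z_n)_{n\ge 1}$ be the sequence of points in $[0,1)^d$ produced by the Haar $(1+\beta)$-thinning strategy. Then, almost surely, $$\limsup_{n\to\infty}\frac{\mathrm{Dis}(Z^n)}{\log^{2d+1}(n)}\le\frac{100(d^2+1)}{\beta}.$$
   Context: Throughout, $\log$ is the logarithm to base $2$, $\log^a(n)=(\log n)^a$, $|A|$ is the Lebesgue measure of $A$, $\mathbb N=\{1,2,\dots\}$, and $\mathrm{sgn}(0)=0$. Discrepancy. For a sequence $Z=(Z_i)$ in $[0,1)^d$ write $Z^n=(Z_1,\dots,Z_n)$ and $$\mathrm{Dis}(Z^n)=\sup_{R}\Big|\#\{i\le n: Z_i\in R\}-n|R|\Big|,$$ the supremum being over all axis-parallel rectangles $R=\prod_{i=1}^d[a_i,b_i)$ with $0\le a_i<b_i\le 1$. Haar functions. A dyadic interval is $I=[a2^{-\ell},(a+1)2^{-\ell})$ with $a,\ell\in\mathbb Z$; its order is $\mathcal O(I)=\ell$, and $I_{\mathrm{even}}$, $I_{\mathrm{odd}}$ denote its left and right halves (dyadic intervals of order $\ell+1$). Each dyadic interval $I$ with $I_{\mathrm{even}}\subset[0,1)$ gives a Haar function $H_I:[0,1)\to\{-1,0,1\}$ equal to $1$ on $I_{\mathrm{even}}$, $-1$ on $I_{\mathrm{odd}}\cap[0,1)$ and $0$ elsewhere, of order $\mathcal O(H_I)=\mathcal O(I)+1$ (so $I=[0,2)$ gives the constant function $1$, of order $0$). For a product $R=I_1\times\dots\times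 I_d$ of such intervals put $H_R(x)=\prod_{i=1}^dH_{I_i}(x_i)$, with order $\mathcal O(H_R)=\sum_{i=1}^d\mathcal O(H_{I_i})$. Let $\mathcal H_{h_0}^{h_1}$ be the set of Haar functions $H_R$ on $[0,1)^d$ with $h_0\le\mathcal O(H_R)\le h_1$. For a finite counting measure $\nu$, $\langle\nu,H\rangle=\int H\,d\nu$. Conditional density. Let $h(n)=\lfloor\log n\rfloor$ and $W(s)=\sum_{i=1}^s\binom{i+d-1}{d-1}$. For a counting measure $\nu$ and $n\in\mathbb N$ put $$\lambda_n(\nu)(x)=1+\frac{\beta}{2W(h(n))}\sum_{H\in\mathcal H_1^{h(n)}}\mathrm{sgn}\big(\langle\nu,-H\rangle\big)H(x),$$ with $\lambda_1\equiv1$ (empty sum). Thinning. A two-thinning strategy is a sequence of measurable functions $f_n:([0,1)^d)^{n-1}\times[0,1)^d\to[0,1]$; it is a $(1+\beta)$-thinning strategy if for all $z_1,\dots,z_{n-1}$ one has $f_n((z_1,\dots,z_{n-1}),x)\ge1-\beta$ for almost every $x$. Let $(X_m)_{m\ge1}$ be i.i.d. uniform on $[0,1)^d$ and $(U_n)_{n\ge1}$ i.i.d. uniform on $[0,1]$, independent of $(X_m)$. The strategy produces $Z$ inductively: $$\chi_n=\mathbf 1\Big\{U_n>f_n\big((Z_1,\dots,Z_{n-1}),X_{n+\sum_{i=1}^{n-1}\chi_i}\big)\Big\},\qquad Z_n=X_{n+\sum_{i=1}^n\chi_i}.$$ The Haar $(1+\beta)$-thinning strategy is the one given by $f_n((z_1,\dots,z_{n-1}),x)=\lambda_n\big(\sum_{i=1}^{n-1}\delta_{z_i}\big)(x)-\frac{\beta}{2}$.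 Equivalently, the law of $Z_n$ given $Z_1,\dots,Z_{n-1}$ has density $\lambda_n(\nu_{n-1})$, where $\nu_{n-1}=\sum_{i=1}^{n-1}\delta_{Z_i}$. *)

(* Defs.v *)
From HB Require Import structures.
From mathcomp Require Import finmap.
From mathcomp Require Import all_boot all_order all_algebra.
From mathcomp Require Import all_classical all_reals all_analysis.

Set Implicit Arguments.
Unset Strict Implicit.
Unset Printing Implicit Defensive.

Import Order.TTheory GRing.Theory Num.Theory.
Import numFieldNormedType.Exports.

Local Open Scope classical_set_scope.
Local Open Scope ring_scope.

Definition log2 (R : realType) (x : R) : R := ln x / ln 2.

(* Points of R^d are d-tuples of reals, with the product sigma-algebra. *)

Definition unit_cube (R : realType) (d : nat) : set (d.-tuple R) :=
  [set x | forall i, 0 <= tnth x i < 1].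

Arguments unit_cube R d : clear implicits.

Definition box (R : realType) (d : nat) (a b : d.-tuple R) : set (d.-tuple R) :=
  [set x | forall i, tnth a i <= tnth x i < tnth b i].

(* d-dimensional Lebesgue measure as the d-fold product of the one-dimensional
   one: the recursive step is the formula defining [mu1 \x mu2]. *)
Fixpoint lebesgue_tuple (R : realType) (d : nat) :
    set (d.-tuple R) -> \bar R :=
  match d with
  | 0 => fun A => (\1_A [tuple])%:E
  | d'.+1 => fun A =>
      (\int[lebesgue_measure]_x
         lebesgue_tuple [set y : d'.-tuple R | A [tuple of x :: y]])%E
  end.

(* [s] is the finite sequence Z^n, so [size s] is n.  The set whose supremum is
   taken is bounded by n, and nonempty. *)
Definition Dis (R : realType) (d : nat) (s : seq (d.-tuple R)) : R :=
  sup [set r | exists a b : d.-tuple R,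
    (forall i, 0 <= tnth a i /\ tnth a i < tnth b i /\ tnth b i <= 1) /\
    r = `| (count (fun z => z \in box a b) s)%:R
           - (size s)%:R * fine (lebesgue_tuple (box a b)) | ].

(* The pair (a, l) stands for the dyadic interval [a 2^-l, (a + 1) 2^-l). *)
Definition dyadic_interval (R : realType) (I : int * int) : set R :=
  `[I.1%:~R * 2 ^ (- I.2), (I.1 + 1)%:~R * 2 ^ (- I.2)[%classic.

Arguments dyadic_interval R I : clear implicits.

Definition dyadic_even (I : int * int) : int * int := (2 * I.1, I.2 + 1).

Definition dyadic_odd (I : int * int) : int * int := (2 * I.1 + 1, I.2 + 1).

Definition haar1 (R : realType) (I : int * int) (x : R) : R :=
  \1_(dyadic_interval R (dyadic_even I)) x
  - \1_(dyadic_interval R (dyadic_odd I) `&` `[0, 1[%classic) x.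

Definition haar (R : realType) (d : nat) (I : d.-tuple (int * int))
    (x : d.-tuple R) : R :=
  \prod_(i < d) haar1 (tnth I i) (tnth x i).

Definition haar_order (d : nat) (I : d.-tuple (int * int)) : int :=
  \sum_(i < d) ((tnth I i).2 + 1).

(* The index set of the Haar functions on [0,1)^d of order between h0 and h1:
   distinct indices give distinct functions, so that a sum over this (finite)
   set is a sum over the functions themselves. *)
Definition haar_index (R : realType) (d : nat) (h0 h1 : int) :
    set (d.-tuple (int * int)) :=
  [set I | (forall i, dyadic_interval R (dyadic_even (tnth I i)) `<=` `[0, 1[%classic)
           /\ h0 <= haar_order I <= h1].

Arguments haar_index R d h0 h1 : clear implicits.

(* <nu, F> for the counting measure nu of the points listed in [nu]. *)
Definition pairing (R : realType) (d : nat) (nu : seq (d.-tuple R))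
    (F : d.-tuple R -> R) : R :=
  \sum_(z <- nu) F z.

Definition haar_W (d s : nat) : nat :=
  (\sum_(1 <= i < s.+1) 'C(i + d - 1, d - 1))%N.

(* [trunc_log 2 n] is the integer part of the binary logarithm of n. *)
Definition haar_density (R : realType) (d : nat) (beta : R) (n : nat)
    (nu : seq (d.-tuple R)) (x : d.-tuple R) : R :=
  1 + beta / (2 * (haar_W d (trunc_log 2 n))%:R) *
    \sum_(I \in haar_index R d 1 (trunc_log 2 n)%:Z)
      Num.sg (pairing nu (fun y => - haar I y)) * haar I x.

(* A two-thinning strategy is presented as one function of the list of the
   points already produced: f_n is its restriction to lists of length n - 1. *)
Definition haar_strategy (R : realType) (d : nat) (beta : R)
    (z : seq (d.-tuple R)) (x : d.-tuple R) : R :=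
  haar_density beta (size z).+1 z x - beta / 2.

(* All sequences are indexed from 0: [x n], [u n], [chi n], [z n] stand for
   X_(n+1), U_(n+1), chi_(n+1), Z_(n+1).  In particular [mkseq z n] is Z^n. *)
Definition thinning (R : realType) (d : nat)
    (f : seq (d.-tuple R) -> d.-tuple R -> R)
    (x : nat -> d.-tuple R) (u : nat -> R)
    (chi : nat -> bool) (z : nat -> d.-tuple R) : Prop :=
  forall n : nat,
    chi n = (f (mkseq z n) (x (n + \sum_(i < n) chi i)%N) < u n) /\
    z n = x (n + \sum_(i < n.+1) chi i)%N.

Definition mutually_independent (d1 d2 : measure_display)
    (T : measurableType d1) (S : measurableType d2) (R : realType)
    (P : probability T R) (Y : nat -> {RV P >-> S}) : Prop :=
  forall (J : {fset nat}) (A : nat -> set S), (forall i, measurable (A i)) ->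
    P (\bigcap_(i in [set` J]) (Y i @^-1` A i)) =
    (\prod_(i <- J) P (Y i @^-1` A i))%E.

Definition sigma_of (d1 d2 : measure_display)
    (T : measurableType d1) (S : measurableType d2) (R : realType)
    (P : probability T R) (Y : nat -> {RV P >-> S}) : set (set T) :=
  <<s \bigcup_n preimage_set_system setT (Y n) measurable >>.

Definition independent_sequences (d1 d2 d3 : measure_display)
    (T : measurableType d1) (S : measurableType d2) (S' : measurableType d3)
    (R : realType) (P : probability T R)
    (Y : nat -> {RV P >-> S}) (Y' : nat -> {RV P >-> S'}) : Prop :=
  forall A B : set T, sigma_of Y A -> sigma_of Y' B ->
    P (A `&` B) = (P A * P B)%E.

Definition uniform_on_cube (dT : measure_display) (T : measurableType dT)
    (R : realType) (d : nat) (P : probability T R)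
    (Y : {RV P >-> d.-tuple (measurableTypeR R)}) : Prop :=
  forall A : set (d.-tuple (measurableTypeR R)), measurable A ->
    distribution P Y A = lebesgue_tuple (A `&` unit_cube R d).

Definition uniform_on_itv01 (dT : measure_display) (T : measurableType dT)
    (R : realType) (P : probability T R) (V : {RV P >-> measurableTypeR R}) : Prop :=
  forall A : set (measurableTypeR R), measurable A ->
    distribution P V A = uniform_prob (@ltr01 R) A.

(* Main.v *)
(* Let h = h(n). A box indicator is approximated, up to Haar functions of order larger
   than h supported near its faces, by a combination of products of one-dimensional
   Haar functions of order at most h each; the coefficients have l^1 norm at most
   (h + 1)^d. Hence the discrepancy is controlled by S_H = <nu, H> for the H of order
   between 1 and h, and by the number N_H of points in the support of H for those of
   larger order.

   By orthogonality of the Haar functions, the density lambda_n gives S_H a drift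
   of size beta |supp H| / (2 W(h(n))) towards 0. With theta = beta / (6 W(h)), the
   moment E[exp(theta S_H) + exp(- theta S_H)] is therefore at most linear in n,
   while E[exp(N_H)] is bounded when n <= 2^(order of H). Markov's inequality, a union
   bound over the 2^((h + 1) d) products at scale 2^-(h + 1), and the Borel-Cantelli
   lemma give the rate.

   All these Haar functions are constant on dyadic cells of side 2^-(h + 1), so only
   the sequence of the cells of Z_1, ..., Z_n matters: its law has finite support and
   is bounded by the product of the cell masses and of the densities lambda_i. *)

Require Import Defs.
From HB Require Import structures.
From mathcomp Require Import finmap.
From mathcomp Require Import all_boot all_order all_algebra.
From mathcomp Require Import all_classical all_reals all_analysis.
From mathcomp Require Import ring lra zify.

Set Implicit Arguments.
Unset Strict Implicit.
Unset Printing Implicit Defensive.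

Import Order.TTheory GRing.Theory Num.Theory.
Import numFieldNormedType.Exports.

Local Open Scope classical_set_scope.
Local Open Scope ring_scope.

(** The exponent 2d + 1 collects three losses: (h + 1)^d from the expansion of a box; W(h) <= (h +
    1)^d because the room beta / 2 for correcting the density is shared among W(h) multi-orders,
    which makes 1 / theta the natural scale of S_H; and one factor h + 1 from the logarithm of the
    number of events to be excluded at time n.

    A function of order k is not corrected before step 2^k. Its support has measure p with p 2^k <=
    2^d, so growth at a rate proportional to p during those steps costs only a factor depending on
    d. The same estimate controls N_H when the order exceeds h, for then 2^k > n.

    At S_H = 0 the sign is 0 and there is no drift. The moment is thus only shown to gain a bounded
    amount per step, and the resulting factor n is absorbed by a threshold proportional to h + 1.

    [Z] and [chi] are plain functions satisfying the recursion. Events about them are rewritten as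
    finite unions of events about candidates and thresholds, which gives their measurability; only
    upper bounds of their probabilities enter. *)

Definition haar_valid (R : realType) (I : int * int) : Prop :=
  dyadic_interval R (dyadic_even I) `<=` `[0, 1[%classic.

(** * Haar functions of one variable *)

Lemma dyadic_intervalE (R : realType) (m k : nat) (x : R) :
  dyadic_interval R (m%:Z, k%:Z) x =
  ((0 <= x) && (Num.truncn (2 ^+ k * x) == m)) :> Prop.
Proof.
rewrite /dyadic_interval /= in_itv /=.
have p : (0 : R) < 2 ^+ k by apply: exprn_gt0.
rewrite -exprnN ler_pdivrMr // ltr_pdivlMr // [x * _]mulrC intrD -!pmulrn.
apply/propext; split.
  move=> /andP[h1 h2].
  have h0 : 0 <= 2 ^+ k * x by apply: le_trans h1.
  have x0 : 0 <= x by move: h0; rewrite pmulr_rge0.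
  by rewrite x0 truncn_eq //= h1 -[m.+1%:R]natr1.
move=> /andP[x0]; rewrite truncn_eq; last by rewrite mulr_ge0 // ltW.
by rewrite -[m.+1%:R]natr1.
Qed.

Lemma truncn_exp2_lt (R : realType) (k : nat) (x : R) :
  0 <= x < 1 -> (Num.truncn (2 ^+ k * x) < 2 ^ k)%N.
Proof.
move=> /andP[x0 x1]; have p : (0 : R) < 2 ^+ k by apply: exprn_gt0.
by rewrite truncn_lt_nat ?(mulr_ge0 (ltW p)) // natrX gtr_pMr.
Qed.

(** The pair [(0, -1)] is the interval [0, 2), the only valid one of negative order: its left half
    is [0, 1) and its right half misses [0, 1). *)
Lemma haar1_const (R : realType) (x : R) :
  haar1 (0, - 1%:Z) x = (0 <= x < 1)%R%:R.
Proof.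
have p : (0 : R) < 2 ^+ 0 by apply: exprn_gt0.
have e : dyadic_interval R (dyadic_even (0, - 1%:Z)) = `[0, 1[%classic.
  apply/funext => y; rewrite /dyadic_even /= mulr0 addNr.
  rewrite (dyadic_intervalE 0 0) expr0 mul1r /= in_itv /=.
  apply/propext; split => /andP[y0]; first by rewrite truncn_eq // => /andP[].
  by move=> y1; rewrite y0 truncn_eq // y0.
have o : dyadic_interval R (dyadic_odd (0, - 1%:Z)) `&` `[0, 1[ = set0.
  rewrite -subset0 => y []; rewrite /dyadic_odd /= mulr0 addNr add0r.
  rewrite dyadic_intervalE expr0 mul1r /= in_itv /= => /andP[y0 h] /andP[_ y1].
  by move: h; rewrite truncn_eq // => /andP[]; rewrite leNgt y1.
rewrite /haar1 e o indic0 /= subr0 indicE.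
by congr ((nat_of_bool _)%:R); apply/idP/idP => [/set_mem|h]; [|apply/mem_set]; rewrite /= in_itv.
Qed.

Lemma haar1_nat (R : realType) (a l : nat) (x : R) : (a < 2 ^ l)%N ->
  haar1 (a%:Z, l%:Z) x =
  if 0 <= x < 1 then (Num.truncn (2 ^+ l.+1 * x) == a.*2)%:R
    - (Num.truncn (2 ^+ l.+1 * x) == a.*2.+1)%:R else 0.
Proof.
move=> al; have p : (0 : R) < 2 ^+ l.+1 by apply: exprn_gt0.
have eve : dyadic_even (a%:Z, l%:Z) = (a.*2%:Z, l.+1%:Z).
  by rewrite /dyadic_even /=; congr pair; lia.
have ode : dyadic_odd (a%:Z, l%:Z) = (a.*2.+1%:Z, l.+1%:Z).
  by rewrite /dyadic_odd /=; congr pair; lia.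
have key (m : nat) : (m < 2 ^ l.+1)%N -> 0 <= x ->
    Num.truncn (2 ^+ l.+1 * x) = m -> x < 1.
  move=> ml x0 /eqP; rewrite truncn_eq ?(mulr_ge0 (ltW p)) // => /andP[_ h].
  rewrite -(ltr_pM2l p) mulr1 (lt_le_trans h) // -natrX ler_nat //.
rewrite /haar1 eve ode !indicE; case: ifPn => [x01|x01].
  have x0 : 0 <= x by case/andP: x01.
  congr (_ - _); congr ((nat_of_bool _)%:R).
    by apply/idP/idP => [/set_mem|h]; [|apply/mem_set];
      rewrite dyadic_intervalE x0.
  apply/idP/idP => [/set_mem []|h]; [|apply/mem_set; split];
      rewrite ?dyadic_intervalE ?x0 //.
have -> : (x \in dyadic_interval R (a.*2%:Z, l.+1%:Z)) = false.
  apply/negbTE/negP => /set_mem; rewrite dyadic_intervalE => /andP[x0 /eqP e].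
  by move: x01; rewrite x0 (key _ _ x0 e) // expnS; lia.
have -> : (x \in dyadic_interval R (a.*2.+1%:Z, l.+1%:Z) `&` `[0, 1[) = false.
  by apply/negbTE/negP => /set_mem [_]; rewrite /= in_itv /= (negbTE x01).
by rewrite subr0.
Qed.

(** Containment needs testing at two points of the left half only. Its left endpoint gives the range
    of [a], and forces [a = 0] when the order is negative; its midpoint then excludes a left half of
    length 2 or more. *)
Lemma haar_validP (R : realType) (I : int * int) : haar_valid R I <->
  I = (0, - 1%:Z) \/ exists a l : nat, I = (a%:Z, l%:Z) /\ (a < 2 ^ l)%N.
Proof.
split; last first.
  case=> [->|[a [l [-> al]]]] x.
    rewrite /dyadic_even /= mulr0 addNr.
    rewrite (dyadic_intervalE 0 0) expr0 mul1r /= in_itv /= => /andP[y0].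
    by rewrite y0 truncn_eq // => /andP[].
  have -> : dyadic_even (a%:Z, l%:Z) = (a.*2%:Z, l.+1%:Z).
    by rewrite /dyadic_even /=; congr pair; lia.
  have p : (0 : R) < 2 ^+ l.+1 by apply: exprn_gt0.
  rewrite dyadic_intervalE /= in_itv /= => /andP[x0].
  rewrite x0 truncn_eq ?(mulr_ge0 (ltW p)) // => /andP[_ h].
  rewrite -(ltr_pM2l p) mulr1 (lt_le_trans h) // -natrX ler_nat // expnS; lia.
case: I => a l; rewrite /haar_valid /dyadic_even /dyadic_interval /= => H.
pose e : R := 2 ^ (- (l + 1)).
have e0 : 0 < e by apply: exprz_gt0.
have H' (t : R) : 0 <= t < 1 -> 0 <= ((2 * a)%:~R + t) * e < 1.
  move=> /andP[t0 t1].
  have := H (((2 * a)%:~R + t) * e); rewrite /= !in_itv /=; apply.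
  rewrite -/e intrD ler_pM2r // ltr_pM2r //.
  by rewrite lerDl t0 ltrD2l t1.
have H0 := H' 0 (introT andP (conj (lexx _) ltr01)).
have [a0 a1] : 0 <= (2 * a)%:~R * e /\ (2 * a)%:~R * e < 1.
  by move: H0; rewrite addr0 => /andP.
have a_ge0 : 0 <= a.
  move: a0; rewrite pmulr_lge0 // ler0z; lia.
case: a a_ge0 {H H0} H' a0 a1 => [a|//] _ H' a0 a1.
have [l0|l0] := leP 0 l.
  right; case: l l0 @e e0 H' a0 a1 => [l|//] _ e e0 H' a0 a1.
  exists a, l; split => //.
  have p : (0 : R) < 2 ^+ l.+1 by apply: exprn_gt0.
  move: a1; rewrite /e -PoszD addn1 -exprnN ltr_pdivrMr // mul1r.
  have -> : (2 * a%:Z) = (a.*2)%:Z by lia.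
  by rewrite -pmulrn -natrX ltr_nat expnS; lia.
left.
have e1 : 1 <= e.
  by rewrite /e (_ : - (l + 1) = (absz (l + 1))%:Z); [rewrite -exprnP exprn_ege1 // ler1n | lia].
have a_eq0 : a = 0%N.
  case: a a1 {H' a0} => // a a1; exfalso; move: a1; apply/negP; rewrite -leNgt.
  apply: le_trans e1 _; apply: ler_peMl (ltW e0) _.
  by rewrite (_ : 1 = 1%:~R) // ler_int; lia.
rewrite a_eq0 in H' *; congr pair.
have [//|l1] := eqVneq l (- 1%:Z).
have e2 : 2 <= e.
  rewrite /e (_ : - (l + 1) = (absz (l + 2)%R).+1%:Z); last by lia.
  by rewrite -exprnP exprS ler_peMr // exprn_ege1 // ler1n.
have := H' (2^-1); rewrite mulr0 mulr0z add0r => /(_ ltac:(lra)) /andP[_].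
rewrite ltNge => /negP[]; lra.
Qed.

Lemma truncn_div (R : realType) (m : nat) (y : R) : (0 < m)%N -> 0 <= y ->
  Num.truncn (y / m%:R) = (Num.truncn y %/ m)%N.
Proof.
move=> m0 y0; have mR : (0 : R) < m%:R by rewrite ltr0n.
apply/eqP; rewrite truncn_eq ?divr_ge0 ?ler0n //.
rewrite ler_pdivlMr // ltr_pdivrMr // -!natrM.
have /andP[h1 h2] := truncn_itv y0.
apply/andP; split.
  by apply: le_trans h1; rewrite ler_nat leq_trunc_div.
by apply: lt_le_trans h2 _; rewrite ler_nat ltn_ceil.
Qed.

(** Coarsening a dyadic level drops binary digits, so nesting of dyadic intervals becomes Euclidean
    division of cell numbers. *)
Lemma truncn_exp2_div (R : realType) (k L : nat) (x : R) : (k <= L)%N ->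
  0 <= x -> Num.truncn (2 ^+ k * x) = (Num.truncn (2 ^+ L * x) %/ 2 ^ (L - k))%N.
Proof.
move=> kL x0; have p n : (0 : R) < 2 ^+ n by apply: exprn_gt0.
rewrite -truncn_div ?expn_gt0 //; last by rewrite mulr_ge0 // ltW.
congr Num.truncn; rewrite natrX mulrAC; congr (_ * _).
by rewrite -{1}(subnK kL) exprD mulrC mulKf // gt_eqF.
Qed.

Lemma haar1_rep (R : realType) (a l L j : nat) : (a < 2 ^ l)%N -> (l < L)%N ->
  haar1 (a%:Z, l%:Z) (j%:R / 2 ^+ L : R) =
  (j %/ 2 ^ (L - l.+1) == a.*2)%N%:R - (j %/ 2 ^ (L - l.+1) == a.*2.+1)%N%:R.
Proof.
move=> al lL; have p n : (0 : R) < 2 ^+ n by apply: exprn_gt0.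
have x0 : 0 <= j%:R / 2 ^+ L :> R by rewrite divr_ge0 // ltW.
rewrite haar1_nat // (truncn_exp2_div lL) //.
rewrite [2 ^+ L * _]mulrC divfK ?(lt0r_neq0 (p L)) // natrK.
rewrite x0 ltr_pdivrMr // mul1r -natrX ltr_nat /=; case: ltnP => // jL.
have : (2 ^ l.+1 <= j %/ 2 ^ (L - l.+1))%N.
  by rewrite leq_divRL ?expn_gt0 // -expnD subnKC.
rewrite expnS => h; rewrite !gtn_eqF ?subrr //; lia.
Qed.

Lemma haar1_const_rep (R : realType) (L j : nat) :
  haar1 (0, - 1%:Z) (j%:R / 2 ^+ L : R) = (j < 2 ^ L)%N%:R.
Proof.
have p n : (0 : R) < 2 ^+ n by apply: exprn_gt0.
by rewrite haar1_const divr_ge0 ?(ltW (p _)) //= ltr_pdivrMr // mul1r -natrX ltr_nat.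
Qed.

Lemma sum_divn (R : pzRingType) (m n : nat) (g : nat -> R) : (0 < m)%N ->
  \sum_(0 <= j < n * m) g (j %/ m)%N = (\sum_(0 <= i < n) g i) *+ m.
Proof.
move=> m0; rewrite big_nat_mul -sumrMnl; apply: eq_bigr => i _.
rewrite big_nat_cond (eq_bigr (fun=> g i)).
  rewrite -big_nat_cond sumr_const_nat; congr (_ *+ _).
  by rewrite mulSn addnK.
move=> j; rewrite andbT => /andP[h1 h2]; congr g.
apply/eqP; rewrite eqn_leq leq_divRL // h1 -ltnS ltn_divLR // h2 //.
Qed.

(** The measure of the support within [0, 1). The default value 1 serves [0, 2), whose Haar function
    has all of [0, 1) as support. *)
Definition haar_mass1 (R : realType) (I : int * int) : R :=
  if I.2 is Posz l then 2 ^- l else 1.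

(** Let J be the finer function. On cells, [haar1 I] depends only on the quotient at the level of
    the halves of J, so the sum is a multiple of the difference of the values of I on these two
    halves. A strictly coarser I takes the same value on both. *)
Lemma haar1_orth (R : realType) (L : nat) (I J : int * int) :
  haar_valid R I -> haar_valid R J -> I.2 + 1 <= L%:Z -> J.2 + 1 <= L%:Z ->
  \sum_(0 <= j < 2 ^ L)
     haar1 I (j%:R / 2 ^+ L : R) * haar1 J (j%:R / 2 ^+ L) =
  if I == J then 2 ^+ L * haar_mass1 R I else 0.
Proof.
wlog IJ : I J / I.2 <= J.2.
  move=> H vI vJ hI hJ; have [h|h] := leP I.2 J.2; first exact: H.
  rewrite eq_sym (eq_bigr _ (fun _ _ => mulrC _ _)) H // ?(ltW h) //.
  by case: eqP => // ->.
move=> /haar_validP vI /haar_validP vJ hI hJ.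
case: vJ => [eJ|[b [m [eJ bm]]]].
  case: vI => [eI|[a [l [eI _]]]]; last by rewrite eI eJ /= in IJ.
  rewrite eI eJ eqxx /= mulr1 (eq_big_nat _ _ (F2 := fun=> 1)).
    by rewrite sumr_const_nat subn0 natrX.
  by move=> j /andP[_ jL]; rewrite haar1_const_rep jL mulr1.
have mL : (m < L)%N by move: hJ; rewrite eJ /=; lia.
have main (g : nat -> R) : (forall j, (j < 2 ^ L)%N ->
    haar1 I (j%:R / 2 ^+ L : R) = g (j %/ 2 ^ (L - m.+1))%N) ->
  \sum_(0 <= j < 2 ^ L)
     haar1 I (j%:R / 2 ^+ L : R) * haar1 J (j%:R / 2 ^+ L) =
  (g b.*2 - g b.*2.+1) *+ 2 ^ (L - m.+1).
  move=> Hg; pose G i : R := g i * ((i == b.*2)%:R - (i == b.*2.+1)%:R).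
  rewrite (eq_big_nat _ _ (F2 := fun j => G (j %/ 2 ^ (L - m.+1))%N)); last first.
    by move=> j /andP[_ jL]; rewrite Hg // eJ haar1_rep.
  rewrite -{1}(subnKC mL) expnD sum_divn ?expn_gt0 //; congr (_ *+ _).
  have b1 : (b.*2 < 2 ^ m.+1)%N by rewrite expnS; lia.
  have b2 : (b.*2.+1 < 2 ^ m.+1)%N by rewrite expnS; lia.
  rewrite big_mkord (bigD1 (Ordinal b1)) //= (bigD1 (Ordinal b2)) /=; last first.
    by rewrite -val_eqE /=; apply/eqP; lia.
  rewrite big1 ?addr0; last first.
    move=> i /andP[]; rewrite -!val_eqE /= => /negbTE h1 /negbTE h2.
    by rewrite /G h1 h2 subrr mulr0.
  rewrite /G !eqxx (_ : (b.*2 == b.*2.+1) = false); last by apply/eqP; lia.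
  rewrite (_ : (b.*2.+1 == b.*2) = false); last by apply/eqP; lia.
  by rewrite subr0 sub0r mulr1 mulrN1.
case: vI => [eI|[a [l [eI al]]]].
  rewrite (main (fun=> 1)); last by move=> j jL; rewrite eI haar1_const_rep jL.
  by rewrite subrr mul0rn eI eJ; case: eqP => // -[].
have lm : (l <= m)%N by move: IJ; rewrite eI eJ.
rewrite (main (fun i => (i %/ 2 ^ (m - l) == a.*2)%N%:R
                       - (i %/ 2 ^ (m - l) == a.*2.+1)%N%:R)); last first.
  move=> j jL; rewrite eI haar1_rep //; last by apply: leq_ltn_trans mL.
  rewrite -!divnMA -!expnD (_ : L - m.+1 + (m - l) = L - l.+1)%N //; lia.
have [e|ne] := eqVneq l m; last first.
  have lt_lm : (l < m)%N by rewrite ltn_neqAle ne.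
  have e2 : (m - l = (m - l.+1).+1)%N by lia.
  have -> : (b.*2.+1 %/ 2 ^ (m - l) = b.*2 %/ 2 ^ (m - l))%N.
    by rewrite e2 expnS !divnMA -muln2 mulnK // -addn1 divnMDl // addn0.
  rewrite subrr mul0rn eI eJ; case: eqP => // -[_ h]; lia.
rewrite e subnn expn0 !divn1 eqSS (_ : (b.*2 == a.*2.+1) = false); last first.
  by apply/eqP; lia.
rewrite (_ : (b.*2.+1 == a.*2) = false); last by apply/eqP; lia.
rewrite subr0 sub0r opprK eI eJ e.
have -> : (a%:Z, m%:Z) == (b%:Z, m%:Z) = (b.*2 == a.*2).
  by apply/eqP/eqP => [[h]|h]; [lia|congr pair; lia].
case: eqP => _; last by rewrite add0r mul0rn.
rewrite /haar_mass1 /= -[in LHS](natrD _ 1 1) -mulrnA mulnC -expnSr natrX.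
rewrite -{2}(subnK (ltnW mL)) exprD mulfK; last by rewrite gt_eqF // exprn_gt0.
by congr (_ ^+ _); lia.
Qed.

Lemma haar1_out (R : realType) (I : int * int) (x : R) :
  haar_valid R I -> ~~ (0 <= x < 1) -> haar1 I x = 0.
Proof.
move=> /haar_validP[->|[a [l [-> al]]]] h.
  by rewrite haar1_const (negbTE h).
by rewrite haar1_nat // (negbTE h).
Qed.

(* [ord_max] is an extra cell, for the points outside [0, 1): it has mass 0. *)
Definition cell1 (R : realType) (L : nat) (x : R) : 'I_(2 ^ L).+1 :=
  if 0 <= x < 1 then inord (Num.truncn (2 ^+ L * x)) else ord_max.

(** The left endpoint of the cell. For the extra cell this is the point 1, where every valid Haar
    function vanishes. *)
Definition rep1 (R : realType) (L : nat) (j : 'I_(2 ^ L).+1) : R :=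
  j%:R / 2 ^+ L.

Lemma haar1_cell (R : realType) (L : nat) (I : int * int) (x : R) :
  haar_valid R I -> I.2 + 1 <= L%:Z ->
  haar1 I (rep1 R (cell1 L x)) = haar1 I x.
Proof.
move=> vI hI; rewrite /cell1; case: ifPn => x01; last first.
  rewrite (haar1_out vI x01) (haar1_out vI) // /rep1 /= natrX divff ?ltxx ?andbF //.
have x0 : 0 <= x by case/andP: x01.
rewrite /rep1 inordK; last by rewrite ltnS ltnW // truncn_exp2_lt.
move: vI hI => /haar_validP[->|[a [l [-> al]]]] /= hI.
  by rewrite haar1_const_rep haar1_const x01 truncn_exp2_lt.
have lL : (l < L)%N by lia.
by rewrite haar1_rep // haar1_nat // x01 -!(truncn_exp2_div lL).
Qed.

Lemma haar1_inj (R : realType) (I J : int * int) (x : R) :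
  haar_valid R I -> haar_valid R J -> I.2 = J.2 ->
  haar1 I x != 0 -> haar1 J x != 0 -> I = J.
Proof.
move=> /haar_validP[->|[a [l [-> al]]]] /haar_validP[->|[b [m [-> bm]]]] //= -[e].
subst m; rewrite !haar1_nat //; case: ifP => _; rewrite ?eqxx //.
set t := Num.truncn _.
have [-> _|h1] := eqVneq t a.*2.
  have [h _|h2] := eqVneq a.*2 b.*2; first by congr pair; lia.
  have [h _|h3] := eqVneq a.*2 b.*2.+1; first by lia.
  by rewrite subr0 eqxx.
have [-> _|h2] := eqVneq t a.*2.+1; last by rewrite subr0 eqxx.
have [h _|h3] := eqVneq a.*2.+1 b.*2; first by lia.
have [h _|h4] := eqVneq a.*2.+1 b.*2.+1; first by congr pair; lia.
by rewrite subr0 eqxx.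
Qed.

Lemma haar1_values (R : realType) (I : int * int) (x : R) :
  haar1 I x \in [:: 0; 1; -1].
Proof.
rewrite /haar1 /dyadic_interval /dyadic_even /dyadic_odd /= !indicE !inE.
case: (boolP (x \in `[_, _[%classic)) => h1; case: (boolP (x \in _ `&` _)) => h2;
  rewrite ?subrr ?subr0 ?sub0r ?eqxx ?orbT //.
Qed.

Lemma haar_values (R : realType) (d : nat) (I : d.-tuple (int * int))
  (x : d.-tuple R) : haar I x \in [:: 0; 1; -1].
Proof.
rewrite /haar; elim/big_ind: _ => [|a b|i _]; rewrite ?inE ?eqxx ?orbT //.
  by move=> /or3P[] /eqP-> /or3P[] /eqP->;
    rewrite ?mul0r ?mulr0 ?mul1r ?mulr1 ?mulN1r ?opprK ?eqxx ?orbT.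
by have := haar1_values (tnth I i) (tnth x i); rewrite !inE.
Qed.

Lemma haar_sqr (R : realType) (d : nat) (I : d.-tuple (int * int))
  (x : d.-tuple R) : haar I x ^+ 2 = `|haar I x|.
Proof.
have := haar_values I x; rewrite !inE => /or3P[] /eqP->;
  by rewrite ?normrN ?normr0 ?normr1 ?expr0n ?expr1n ?sqrrN ?expr1n.
Qed.

(** * Products of Haar functions and the cells of the cube *)

Definition cell (R : realType) (d L : nat) (x : d.-tuple R) :
  {ffun 'I_d -> 'I_(2 ^ L).+1} := [ffun i => cell1 L (tnth x i)].

Definition rep (R : realType) (d L : nat) (c : {ffun 'I_d -> 'I_(2 ^ L).+1}) :
  d.-tuple R := [tuple rep1 R (c i) | i < d].

Definition cell_mass (R : realType) (d L : nat)
    (c : {ffun 'I_d -> 'I_(2 ^ L).+1}) : R :=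
  \prod_(i < d) ((c i < 2 ^ L)%N%:R / 2 ^+ L).

Definition haar_mass (R : realType) (d : nat) (I : d.-tuple (int * int)) : R :=
  \prod_(i < d) haar_mass1 R (tnth I i).

Lemma haar_cell (R : realType) (d L : nat) (I : d.-tuple (int * int))
    (x : d.-tuple R) :
  (forall i, haar_valid R (tnth I i)) -> (forall i, (tnth I i).2 + 1 <= L%:Z) ->
  haar I (rep R (cell L x)) = haar I x.
Proof.
move=> vI hI; apply: eq_bigr => i _.
by rewrite tnth_mktuple ffunE haar1_cell.
Qed.

Lemma haar_orth (R : realType) (d L : nat) (I J : d.-tuple (int * int)) :
  (forall i, haar_valid R (tnth I i)) -> (forall i, haar_valid R (tnth J i)) ->
  (forall i, (tnth I i).2 + 1 <= L%:Z) -> (forall i, (tnth J i).2 + 1 <= L%:Z) ->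
  \sum_(c : {ffun 'I_d -> 'I_(2 ^ L).+1})
     cell_mass R c * (haar I (rep R c) * haar J (rep R c)) =
  if I == J then haar_mass R I else 0.
Proof.
move=> vI vJ hI hJ.
have p : (0 : R) < 2 ^+ L by apply: exprn_gt0.
pose F i (j : 'I_(2 ^ L).+1) : R := (j < 2 ^ L)%N%:R / 2 ^+ L *
  (haar1 (tnth I i) (rep1 R j) * haar1 (tnth J i) (rep1 R j)).
transitivity (\sum_(c : {ffun 'I_d -> 'I_(2 ^ L).+1}) \prod_i F i (c i)).
  apply: eq_bigr => c _; rewrite /cell_mass /haar -!big_split /=.
  by apply: eq_bigr => i _; rewrite /F tnth_mktuple.
rewrite -bigA_distr_bigA /=.
have FE i : \sum_j F i j =
    if tnth I i == tnth J i then haar_mass1 R (tnth I i) else 0.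
  rewrite /F big_ord_recr /= ltnn !mul0r addr0.
  rewrite (eq_bigr (fun j : 'I_(2 ^ L) => (2 ^+ L)^-1 *
    (haar1 (tnth I i) (j%:R / 2 ^+ L) * haar1 (tnth J i) (j%:R / 2 ^+ L)))).
    rewrite -mulr_sumr -(big_mkord xpredT (fun j : nat =>
      haar1 (tnth I i) (j%:R / 2 ^+ L) * haar1 (tnth J i) (j%:R / 2 ^+ L))).
    rewrite haar1_orth //; case: ifP => _; rewrite ?mulr0 // mulrA mulVf ?mul1r //.
  by move=> j _; rewrite /rep1 /= ltn_ord mul1r.
case: eqP => [e|/eqP ne].
  by apply: eq_bigr => i _; rewrite FE e eqxx.
have [i hi] : exists i, tnth I i != tnth J i.
  apply/existsP; rewrite -negb_forall; apply: contra ne => /forallP h.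
  by apply/eqP/eq_from_tnth => i; apply/eqP.
by rewrite (bigD1 i) //= FE (negbTE hi) mul0r.
Qed.

Lemma sum_cell_mass (R : realType) (d L : nat) :
  \sum_(c : {ffun 'I_d -> 'I_(2 ^ L).+1}) cell_mass R c = 1.
Proof.
have p : (0 : R) < 2 ^+ L by apply: exprn_gt0.
rewrite -(bigA_distr_bigA (fun _ (j : 'I_(2 ^ L).+1) => (j < 2 ^ L)%N%:R / 2 ^+ L : R)) /=.
rewrite big1 // => i _; rewrite big_ord_recr /= ltnn mul0r addr0.
rewrite (eq_bigr (fun=> (2 ^+ L)^-1)) => [|j _]; last by rewrite /= ltn_ord mul1r.
by rewrite sumr_const card_ord -[_ *+ (2 ^ L)]mulr_natl natrX mulfV // lt0r_neq0.
Qed.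

Lemma cell_mass_ge0 (R : realType) (d L : nat)
  (c : {ffun 'I_d -> 'I_(2 ^ L).+1}) : 0 <= cell_mass R c.
Proof. by apply: prodr_ge0 => i _; rewrite divr_ge0 // exprn_ge0. Qed.

Lemma haar_mass_ge0 (R : realType) (d : nat) (I : d.-tuple (int * int)) :
  0 <= haar_mass R I.
Proof.
apply: prodr_ge0 => i _; rewrite /haar_mass1.
by case: (tnth I i).2 => // n; rewrite invr_ge0 exprn_ge0.
Qed.

Lemma haar_mass_le1 (R : realType) (d : nat) (I : d.-tuple (int * int)) :
  haar_mass R I <= 1.
Proof.
apply: prodr_ile1 => i _; rewrite /haar_mass1.
case: (tnth I i).2 => [n|n]; last by rewrite ler01 lexx.
by rewrite invr_ge0 exprn_ge0 // invf_le1 ?exprn_gt0 // exprn_ege1 // ler1n.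
Qed.

Lemma haar_valid_order (R : realType) (I : int * int) :
  haar_valid R I -> I.2 + 1 = (absz (I.2 + 1))%:Z.
Proof. by move=> /haar_validP[->|[a [l [-> al]]]] //=; lia. Qed.

Lemma haar_order_nat (R : realType) (d : nat) (I : d.-tuple (int * int)) :
  (forall i, haar_valid R (tnth I i)) ->
  haar_order I = (\sum_(i < d) absz ((tnth I i).2 + 1)%R)%N%:Z.
Proof.
move=> vI; rewrite /haar_order (eq_bigr _ (fun i _ => haar_valid_order (vI i))).
by rewrite -(big_morph Posz PoszD (erefl 0%:Z)).
Qed.

(** A non-constant factor of order o has a support of length 2^(1 - o), so each coordinate loses at
    most a factor 2. This is the origin of 2^d in the moment bounds. *)
Lemma haar_mass_order (R : realType) (d n : nat) (I : d.-tuple (int * int)) :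
  (forall i, haar_valid R (tnth I i)) -> haar_order I = n%:Z ->
  haar_mass R I * 2 ^+ n <= 2 ^+ d.
Proof.
move=> vI; rewrite (haar_order_nat vI) => -[<-].
rewrite -prodrXr /haar_mass -big_split /= -[d in X in _ <= X]card_ord -prodr_const.
apply: ler_prod => i _; have [e|[a [l [e _]]]] := (haar_validP R _).1 (vI i).
  by rewrite e /haar_mass1 /= mul1r expr0 ler01 ler1n.
by rewrite e /haar_mass1 /= addn1 exprS mulrCA mulVf ?mulr1 ?lexx ?ler0n.
Qed.

Lemma haar_order_coord (R : realType) (d L : nat) (I : d.-tuple (int * int)) :
  (forall i, haar_valid R (tnth I i)) -> haar_order I <= L%:Z ->
  forall i, (tnth I i).2 + 1 <= L%:Z.
Proof.
move=> vI; rewrite (haar_order_nat vI) lez_nat => h i.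
rewrite (haar_valid_order (vI i)) lez_nat; apply: leq_trans h.
by rewrite (bigD1 i) //= leq_addr.
Qed.

(* Code 0 is the constant function, and the code 2^l + a with a < 2^l is the
   interval [a 2^-l, (a + 1) 2^-l): the codes below 2^L are those of order at most L. *)
Definition haar_code (m : nat) : int * int :=
  if m is 0 then (0, - 1%:Z)
  else ((m - 2 ^ trunc_log 2 m)%N%:Z, (trunc_log 2 m)%:Z).

Lemma haar_code_valid (R : realType) (m : nat) : haar_valid R (haar_code m).
Proof.
apply/haar_validP; case: m => [|m]; [by left|right].
exists (m.+1 - 2 ^ trunc_log 2 m.+1)%N, (trunc_log 2 m.+1); split => //.
have h1 := @trunc_logP 2 m.+1 isT isT; have := @trunc_log_ltn 2 m.+1 isT.
rewrite expnS; lia.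
Qed.

Lemma haar_code_surj (R : realType) (L : nat) (I : int * int) :
  haar_valid R I -> I.2 + 1 <= L%:Z -> exists2 m, (m < 2 ^ L)%N & I = haar_code m.
Proof.
move=> /haar_validP[->|[a [l [-> al]]]] hL; first by exists 0%N; rewrite // expn_gt0.
have e : trunc_log 2 (a + 2 ^ l) = l.
  by apply: trunc_log_eq => //; rewrite leq_addl expnS; lia.
exists (a + 2 ^ l)%N.
  have lL : (l.+1 <= L)%N by move: hL => /=; lia.
  apply: leq_trans (leq_pexp2l _ lL) => //; rewrite expnS; lia.
case en : (a + 2 ^ l)%N => [|n]; first by have := expn_gt0 2 l; lia.
by rewrite /haar_code -en e addnK.
Qed.

Definition haar_codes (d L : nat) (m : {ffun 'I_d -> 'I_(2 ^ L)}) :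
  d.-tuple (int * int) := [tuple haar_code (m i) | i < d].

Lemma haar_codes_surj (R : realType) (d L : nat) (I : d.-tuple (int * int)) :
  (forall i, haar_valid R (tnth I i)) -> (forall i, (tnth I i).2 + 1 <= L%:Z) ->
  exists m : {ffun 'I_d -> 'I_(2 ^ L)}, I = haar_codes m.
Proof.
move=> vI hI.
have h i : exists m : 'I_(2 ^ L), tnth I i = haar_code m.
  by have [m hm e] := haar_code_surj (vI i) (hI i); exists (Ordinal hm).
have [f hf] := choice h; exists [ffun i => f i].
by apply: eq_from_tnth => i; rewrite tnth_mktuple ffunE.
Qed.

Lemma finite_haar_index (R : realType) (d : nat) (h0 : int) (L : nat) :
  finite_set (haar_index R d h0 L%:Z).
Proof.
apply: (@sub_finite_set _ _ ((@haar_codes d L) @` setT)); last first.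
  exact/finite_image/finite_finset.
move=> I [vI /andP[_ hI]].
by have [m ->] := haar_codes_surj vI (haar_order_coord vI hI); exists m.
Qed.

(** Hockey-stick identity: the successor supplies the term i = 0, which would count the constant
    function. *)
Lemma haar_W_binomial (d s : nat) : (0 < d)%N -> (haar_W d s).+1 = 'C(d + s, d).
Proof.
case: d => // d _; elim: s => [|s IH].
  by rewrite /haar_W big_geq // addn0 binn.
rewrite /haar_W big_nat_recr //= -/(haar_W d.+1 s) -addSn IH.
have -> : (s.+1 + d.+1 - 1 = d.+1 + s)%N by lia.
by rewrite (subn1 d.+1) addnS binS.
Qed.

(* Each point lies in the support of at most one Haar function of each multi-order,
   so these multi-orders are what W(s) counts. *)
Lemma card_haar_orders (d s : nat) : (0 < d)%N ->
  #|[set k : d.-tuple 'I_s.+1 | (1 <= \sum_(i <- k) i <= s)%N]%SET| = haar_W d s.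
Proof.
move=> d0; apply/eqP; rewrite -eqSS haar_W_binomial // -card_partial_ord_partitions.
rewrite [X in _ == X](cardsD1 [tuple ord0 | i < d]) inE.
rewrite big_tuple big1 => [|i _]; last by rewrite tnth_mktuple.
rewrite add1n eqSS; apply/eqP/eq_card => k; rewrite !inE.
rewrite andbC [RHS]andbC; congr (_ && _); rewrite lt0n; congr (~~ _).
rewrite big_tuple sum_nat_eq0; apply/forallP/eqP => [h|-> i]; last first.
  by rewrite tnth_mktuple.
by apply: eq_from_tnth => i; rewrite tnth_mktuple; apply/val_inj/eqP/h.
Qed.

(** By [haar1_inj] in each coordinate, a Haar function that does not vanish at [x] is determined by
    its multi-order, and it contributes 1. *)
Lemma sum_norm_haar (R : realType) (d s : nat) (x : d.-tuple R) : (0 < d)%N ->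
  \sum_(I <- fset_set (haar_index R d 1 s%:Z)) `|haar I x| <= (haar_W d s)%:R.
Proof.
move=> d0; set A := haar_index R d 1 s%:Z; have fA : finite_set A := finite_haar_index _ _ _ _.
pose S := [seq I <- fset_set A | haar I x != 0].
have -> : \sum_(I <- fset_set A) `|haar I x| = (size S)%:R.
  rewrite -sum1_size natr_sum big_filter [RHS]big_mkcond /=; apply: eq_bigr => I _.
  have := haar_values I x; rewrite !inE => /or3P[] /eqP->;
  by rewrite ?normrN ?normr0 ?normr1 ?eqxx ?oppr_eq0 ?oner_eq0.
rewrite ler_nat -card_haar_orders //.
pose k (I : d.-tuple (int * int)) : d.-tuple 'I_s.+1 :=
  [tuple inord (absz ((tnth I i).2 + 1)%R) | i < d].
have SA I : I \in S -> [/\ forall i, haar_valid R (tnth I i),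
    1 <= haar_order I <= s%:Z & haar I x != 0].
  by rewrite mem_filter in_fset_set // => /andP[h /set_mem[]].
have kE I i : I \in S -> tnth (k I) i = absz ((tnth I i).2 + 1)%R :> nat.
  move=> /SA[vI /andP[_ hs] _]; rewrite tnth_mktuple inordK // ltnS.
  by rewrite -lez_nat -(haar_valid_order (vI i)) (haar_order_coord vI hs).
rewrite -(size_map k); have uS : uniq (map k S).
  rewrite map_inj_in_uniq ?filter_uniq ?fset_uniq // => I J IS JS kIJ.
  have [vI _ nI] := SA _ IS; have [vJ _ nJ] := SA _ JS.
  apply: eq_from_tnth => i; apply: (@haar1_inj R _ _ (tnth x i)) => //.
  - have := congr1 (fun t : d.-tuple 'I_s.+1 => tnth t i : nat) kIJ.
    rewrite !kE // => /(congr1 Posz); rewrite -!(haar_valid_order (R := R)) //.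
    exact: addIr.
  - by apply: contraNneq nI => h; rewrite /haar (bigD1 i) //= h mul0r.
  - by apply: contraNneq nJ => h; rewrite /haar (bigD1 i) //= h mul0r.
rewrite -(card_uniqP uS); apply/subset_leq_card/fintype.subsetP => _ /mapP[I IS ->].
have [vI hI _] := SA _ IS; rewrite inE big_tuple.
rewrite (eq_bigr _ (fun i _ => kE I i IS)).
by move: hI; rewrite (haar_order_nat vI) !lez_nat.
Qed.

Lemma cell_mass_haar_const (R : realType) (d L : nat)
    (c : {ffun 'I_d -> 'I_(2 ^ L).+1}) :
  cell_mass R c * haar [tuple (0, - 1%:Z) | i < d] (rep R c) = cell_mass R c.
Proof.
rewrite /cell_mass /haar -big_split /=; apply: eq_bigr => i _.
rewrite !tnth_mktuple haar1_const_rep; case: (_ < _)%N; rewrite ?mulr1 //.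
by rewrite mulr0 mul0r.
Qed.

(** Mean zero is orthogonality to the constant function, the only one of order 0. *)
Lemma sum_cell_haar (R : realType) (d L : nat) (J : d.-tuple (int * int)) :
  (forall i, haar_valid R (tnth J i)) -> (forall i, (tnth J i).2 + 1 <= L%:Z) ->
  1 <= haar_order J ->
  \sum_(c : {ffun 'I_d -> 'I_(2 ^ L).+1}) cell_mass R c * haar J (rep R c) = 0.
Proof.
move=> vJ hJ oJ; pose I0 : d.-tuple (int * int) := [tuple (0, - 1%:Z) | i < d].
rewrite (eq_bigr (fun c : {ffun 'I_d -> 'I_(2 ^ L).+1} => cell_mass R c * (haar I0 (rep R c) * haar J (rep R c)))).
  rewrite haar_orth //; last 2 first.
  - by move=> i; rewrite tnth_mktuple; apply/haar_validP; left.
  - by move=> i; rewrite tnth_mktuple.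
  case: eqP => // e; move: oJ; rewrite -e /haar_order big1 // => i _.
  by rewrite tnth_mktuple.
by move=> c _; rewrite mulrA cell_mass_haar_const.
Qed.

(** * The density: bounds, total mass and drift *)

Definition haar_bias (R : realType) (d s : nat) (nu : seq (d.-tuple R))
    (x : d.-tuple R) : R :=
  \sum_(I <- fset_set (haar_index R d 1 s%:Z))
     Num.sg (pairing nu (fun y => - haar I y)) * haar I x.

Lemma haar_densityE (R : realType) (d n : nat) (beta : R)
    (nu : seq (d.-tuple R)) (x : d.-tuple R) :
  haar_density beta n nu x =
  1 + beta / (2 * (haar_W d (trunc_log 2 n))%:R) * haar_bias (trunc_log 2 n) nu x.
Proof. by rewrite /haar_density fsbig_finite //; exact: finite_haar_index. Qed.

Lemma norm_haar_bias (R : realType) (d s : nat) (nu : seq (d.-tuple R))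
    (x : d.-tuple R) : (0 < d)%N -> `|haar_bias s nu x| <= (haar_W d s)%:R.
Proof.
move=> d0; apply: le_trans (sum_norm_haar s x d0).
apply: le_trans (ler_norm_sum _ _ _) _; apply: ler_sum => I _.
rewrite normrM ler_piMl // normr_sg.
by case: (_ != _); rewrite ?ler01.
Qed.

Lemma haar_density_bounds (R : realType) (d n : nat) (beta : R)
    (nu : seq (d.-tuple R)) (x : d.-tuple R) : (0 < d)%N -> 0 <= beta ->
  1 - beta / 2 <= haar_density beta n nu x <= 1 + beta / 2.
Proof.
move=> d0 b0; rewrite haar_densityE !lerD2l -ler_norml; set W := (haar_W d _)%:R.
have W0 : 0 <= W by rewrite ler0n.
have c0 : 0 <= beta / (2 * W) by rewrite divr_ge0 // mulr_ge0.
rewrite normrM (ger0_norm c0).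
apply: le_trans (ler_wpM2l c0 (norm_haar_bias _ _ _ d0)) _; rewrite -/W.
(* W vanishes when h(n) = 0; division by zero then returns 0 and the density is 1. *)
have [->|Wn] := eqVneq W 0; first by rewrite mulr0 divr_ge0.
by rewrite invfM mulrA mulfVK.
Qed.

Lemma pairingN (R : realType) (d : nat) (nu : seq (d.-tuple R))
    (F : d.-tuple R -> R) : pairing nu (fun y => - F y) = - pairing nu F.
Proof. by rewrite /pairing sumrN. Qed.

Lemma haar_index_coord (R : realType) (d s L : nat) (I : d.-tuple (int * int)) :
  (s <= L)%N -> I \in fset_set (haar_index R d 1 s%:Z) ->
  [/\ forall i, haar_valid R (tnth I i), forall i, (tnth I i).2 + 1 <= L%:Z &
      1 <= haar_order I].
Proof.
move=> sL; rewrite in_fset_set; last exact: finite_haar_index.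
move=> /set_mem[vI /andP[h1 h2]]; split => //.
by apply: haar_order_coord vI _; apply: le_trans h2 _; rewrite lez_nat.
Qed.

Lemma haar_density_cell (R : realType) (d L n : nat) (beta : R)
    (nu : seq (d.-tuple R)) (x : d.-tuple R) : (trunc_log 2 n <= L)%N ->
  haar_density beta n [seq rep R (cell L y) | y <- nu] (rep R (cell L x)) =
  haar_density beta n nu x.
Proof.
move=> nL; rewrite !haar_densityE; congr (_ + _ * _).
apply: eq_big_seq => I /(haar_index_coord nL)[vI hI _].
rewrite haar_cell // /pairing big_map; congr (Num.sg _ * _).
by apply: eq_bigr => y _; rewrite haar_cell.
Qed.

Lemma sum_cell_density (R : realType) (d L n : nat) (beta : R)
    (nu : seq (d.-tuple R)) : (trunc_log 2 n <= L)%N ->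
  \sum_(c : {ffun 'I_d -> 'I_(2 ^ L).+1})
     cell_mass R c * haar_density beta n nu (rep R c) = 1.
Proof.
move=> nL; under eq_bigr => c _ do rewrite haar_densityE mulrDr mulr1.
rewrite big_split /= sum_cell_mass.
under eq_bigr => c _ do rewrite mulrCA /haar_bias mulr_sumr.
rewrite -mulr_sumr exchange_big /= big1_seq ?mulr0 ?addr0 // => I /andP[_].
move=> /(haar_index_coord nL)[vI hI oI].
under eq_bigr => c _ do rewrite mulrCA.
by rewrite -mulr_sumr sum_cell_haar // mulr0.
Qed.

Lemma sum_cell_density_haar (R : realType) (d L n : nat) (beta : R)
    (nu : seq (d.-tuple R)) (J : d.-tuple (int * int)) :
  (trunc_log 2 n <= L)%N ->
  (forall i, haar_valid R (tnth J i)) -> (forall i, (tnth J i).2 + 1 <= L%:Z) ->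
  1 <= haar_order J ->
  \sum_(c : {ffun 'I_d -> 'I_(2 ^ L).+1})
     cell_mass R c * haar_density beta n nu (rep R c) * haar J (rep R c) =
  if haar_order J <= (trunc_log 2 n)%:Z then
    - (beta / (2 * (haar_W d (trunc_log 2 n))%:R)
       * Num.sg (pairing nu (haar J)) * haar_mass R J) else 0.
Proof.
move=> nL vJ hJ oJ; set k := beta / _; set s := trunc_log 2 n.
transitivity (\sum_(c : {ffun 'I_d -> 'I_(2 ^ L).+1}) cell_mass R c * haar J (rep R c)
  + k * \sum_(I <- fset_set (haar_index R d 1 s%:Z))
   Num.sg (pairing nu (fun y => - haar I y)) *
  \sum_(c : {ffun 'I_d -> 'I_(2 ^ L).+1}) cell_mass R c * (haar I (rep R c) * haar J (rep R c))).
  under [in X in _ + _ * X]eq_bigr => I _ do rewrite mulr_sumr.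
  rewrite exchange_big /= mulr_sumr -big_split /=; apply: eq_bigr => c _.
  rewrite haar_densityE -/k -/s mulrDr mulr1 mulrDl; congr (_ + _).
  rewrite [_ * (k * _)]mulrCA -[k * _ * _]mulrA; congr (k * _).
  rewrite /haar_bias mulr_sumr mulr_suml; apply: eq_bigr => I _; ring.
rewrite sum_cell_haar // add0r.
have eI I : I \in fset_set (haar_index R d 1 s%:Z) ->
   Num.sg (pairing nu (fun y => - haar I y)) *
  \sum_(c : {ffun 'I_d -> 'I_(2 ^ L).+1}) cell_mass R c * (haar I (rep R c) * haar J (rep R c))
  = if I == J then - (Num.sg (pairing nu (haar J)) * haar_mass R J) else 0.
  move=> /(haar_index_coord nL)[vI hI _]; rewrite haar_orth //.
  by case: eqP => [->|_]; rewrite ?mulr0 // pairingN sgrN mulNr.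
rewrite (eq_big_seq _ eI) -big_mkcond /=.
have mJ : (J \in fset_set (haar_index R d 1 s%:Z)) = (haar_order J <= s%:Z).
  rewrite in_fset_set; last exact: finite_haar_index.
  apply/idP/idP => [/set_mem[_ /andP[]]//|h].
  by apply/mem_set; split => //; rewrite oJ.
case: ifPn; rewrite -mJ => h.
  by rewrite -big_filter filter_pred1_uniq ?fset_uniq // big_seq1 mulrN mulrA.
rewrite big1_seq ?mulr0 // => I /andP[/eqP->] hJ'.
by rewrite hJ' in h.
Qed.

(** Since [haar J] squared is its absolute value, the diagonal case of [haar_orth] gives the measure
    of the support; 3/2 bounds the density because beta is at most 1. *)
Lemma sum_cell_density_norm_haar (R : realType) (d L n : nat) (beta : R)
    (nu : seq (d.-tuple R)) (J : d.-tuple (int * int)) : (0 < d)%N ->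
  0 <= beta <= 1 ->
  (forall i, haar_valid R (tnth J i)) -> (forall i, (tnth J i).2 + 1 <= L%:Z) ->
  \sum_(c : {ffun 'I_d -> 'I_(2 ^ L).+1})
     cell_mass R c * haar_density beta n nu (rep R c) * `|haar J (rep R c)| <=
  3 / 2 * haar_mass R J.
Proof.
move=> d0 /andP[b0 b1] vJ hJ.
have := haar_orth vJ vJ hJ hJ; rewrite eqxx => <-.
rewrite mulr_sumr; apply: ler_sum => c _.
rewrite -expr2 haar_sqr mulrA [3 / 2 * _]mulrC.
have /andP[_ h] := haar_density_bounds n nu (rep R c) d0 b0.
apply: ler_wpM2r => //; apply: ler_wpM2l; first exact: cell_mass_ge0.
by apply: le_trans h _; lra.
Qed.

(** * The law of a finite history of a two-thinning process *)

Lemma measure_big_setU (dT : measure_display) (T : measurableType dT)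
    (R : realType) (P : {measure set T -> \bar R}) (I : Type) (r : seq I)
    (A : I -> set T) : (forall i, measurable (A i)) ->
  measurable (\big[setU/set0]_(i <- r) A i) /\
  (P (\big[setU/set0]_(i <- r) A i) <= \sum_(i <- r) P (A i))%E.
Proof.
move=> mA; elim: r => [|i r [mr IH]]; first by rewrite !big_nil measure0.
rewrite !big_cons; split; first exact: measurableU.
by apply: (le_trans (measureU2 _ (mA i) mr)); exact: leeD2l.
Qed.

(* [(true, r)] is the event U <= r that the candidate point is kept, and
   [(false, r)] the event r < U that it is rejected. *)
Definition threshold_set (R : realType) (br : bool * R) : set R :=
  [set x | if br.1 then x <= br.2 else br.2 < x].

Definition threshold_mass (R : realType) (br : bool * R) : R :=
  if br.1 then br.2 else 1 - br.2.

Fixpoint future_cells (T : Type) (C : Type) (D : nat -> T -> C) (k : nat)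
    (s : seq C) : set T :=
  if s is a :: s' then [set w | D k w = a] `&` future_cells D k.+1 s' else setT.

Fixpoint future_thresholds (T : Type) (R : realType) (U : nat -> T -> R) (k : nat)
    (t : seq (bool * R)) : set T :=
  if t is br :: t' then [set w | threshold_set br (U k w)]
    `&` future_thresholds U k.+1 t' else setT.

(** Either the candidate in cell [a] is kept, or some candidate in a cell [b] is rejected and the
    next one is taken unconditionally. The latter has density 1 relative to [v], hence a summand
    that does not depend on [a]. *)
Definition thinning_density (R : realType) (C : finType) (v : C -> R)
    (F : seq C -> C -> R) (c : seq C) (a : C) : R :=
  F c a + \sum_b v b * (1 - F c b).

(** On the reversed list, structural recursion peels off the latest point, whose factor depends on
    all the earlier ones. *)
Fixpoint rev_history_mass (R : realType) (C : finType) (v : C -> R)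
    (lam : seq C -> C -> R) (r : seq C) : R :=
  if r is a :: r' then rev_history_mass v lam r' * (v a * lam (rev r') a) else 1.

Definition history_mass (R : realType) (C : finType) (v : C -> R)
  (lam : seq C -> C -> R) (c : seq C) : R := rev_history_mass v lam (rev c).

Lemma history_mass_rcons (R : realType) (C : finType) (v : C -> R)
  (lam : seq C -> C -> R) (c : seq C) (a : C) :
  history_mass v lam (rcons c a) = history_mass v lam c * (v a * lam c a).
Proof. by rewrite /history_mass rev_rcons /= revK. Qed.

Section History.
Context (dT : measure_display) (T : measurableType dT) (R : realType).
Variables (P : probability T R) (C : finType) (D : nat -> T -> C).
Variables (U : nat -> T -> R) (v : C -> R) (F : seq C -> C -> R) (N : nat).
Variables (chi : nat -> T -> bool) (z : nat -> T -> C).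
Hypothesis mD : forall k a, measurable [set w | D k w = a].
Hypothesis mU : forall k br, measurable [set w | threshold_set br (U k w)].
Hypothesis F01 : forall c a, 0 <= F c a <= 1.
Hypothesis rect : forall s t, all (fun br : bool * R => 0 <= br.2 <= 1) t ->
  (P (future_cells D 0 s `&` future_thresholds U 0 t) <=
   ((\prod_(a <- s) v a) * (\prod_(br <- t) threshold_mass br))%:E)%E.
(** The restriction to [n < N] reflects that cells of a fixed level determine the strategy only for
    boundedly many steps. *)
Hypothesis chiE : forall n w, (n < N)%N ->
  chi n w = (F (mkseq (z^~ w) n) (D (n + \sum_(i < n) chi i w)%N w) < U n w).
Hypothesis zE : forall n w, z n w = D (n + \sum_(i < n.+1) chi i w)%N w.

Let past (c : seq C) (j : nat) : set T :=
  [set w | mkseq (z^~ w) (size c) = c /\ (\sum_(i < size c) chi i w = j)%N].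

(** The first set is acceptance of candidate [size c + j]. The second is rejection of the candidate
    before it, in an arbitrary cell [b], which raises the number of rejections from [j'] to [j]. *)
Let past_rcons (c : seq C) (a : C) (j : nat) : (size c < N)%N ->
  past (rcons c a) j =
  past c j `&` ([set w | D (size c + j)%N w = a]
    `&` [set w | threshold_set (true, F c a) (U (size c) w)])
  `|` (if j is j'.+1 then \big[setU/set0]_(b <- index_enum C)
     (past c j' `&` ([set w | D (size c + j')%N w = b]
        `&` [set w | D (size c + j)%N w = a]
    `&` [set w | threshold_set (false, F c b) (U (size c) w)])) else set0).
Proof.
move=> cN; apply/seteqP; split => w; rewrite /past /= size_rcons.
  rewrite mkseqS /threshold_set /= => -[/rcons_inj[hc za]].
  have := zE (size c) w; have := chiE w cN; rewrite hc za big_ord_recr /=.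
  set j0 := (\sum_(i < size c) chi i w)%N.
  case: (chi _ w) => /esym hF ha hj; last first.
    left; rewrite -hj addn0 ha addn0; split => //; split => //.
    by rewrite leNgt hF.
  right; rewrite -hj addn1.
  rewrite -bigcup_seq; exists (D (size c + j0)%N w); first by rewrite /= mem_index_enum.
  by split => //; split => //; split => //; rewrite ha addn1.
move=> [[[hc hj] []]|].
  rewrite /threshold_set /= => ha hU.
  have hchi : chi (size c) w = false.
    by rewrite chiE // hc hj ha ltNge hU.
  by rewrite mkseqS big_ord_recr /= hchi addn0 hj hc zE big_ord_recr /= hchi addn0 hj ha.
case: j => // j; rewrite -bigcup_seq => -[b _ [[hc hj] [[hb ha]]]].
rewrite /threshold_set /= => hU.
have hchi : chi (size c) w = true by rewrite chiE // hc hj hb.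
by rewrite mkseqS big_ord_recr /= hchi hj hc zE big_ord_recr /= hchi hj addn1 ha.
Qed.

Let measurable_future_cells k s : measurable (future_cells D k s).
Proof. by elim: s k => //= a s IH k; apply: measurableI. Qed.

Let measurable_future_thresholds k t : measurable (future_thresholds U k t).
Proof. by elim: t k => //= a s IH k; apply: measurableI. Qed.

(* On [past c j] exactly [size c + j] candidates have been consumed. Bounding its
   joint probability with every prescribed future of the candidates and of the
   thresholds stands for the independence of past and future, so that the induction
   needs no conditional probability. The weight [w j] is the mass of [past c j]. *)
Lemma past_bound (c : seq C) : (size c <= N)%N ->
  exists w : nat -> R, [/\ forall j, (size c < j)%N -> w j = 0,
    \sum_(j < (size c).+1) w j = history_mass v (thinning_density v F) c,
    forall j, measurable (past c j) &
    forall j s t, all (fun br : bool * R => 0 <= br.2 <= 1) t ->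
      (P (past c j `&` (future_cells D (size c + j) s
         `&` future_thresholds U (size c) t)) <=
      (w j * ((\prod_(a <- s) v a) * (\prod_(br <- t) threshold_mass br)))%:E)%E].
Proof.
elim/last_ind: c => [_|c a IH].
  exists (fun j => (j == 0%N)%:R); split => [[]//||j|j s t tP].
  - by rewrite big_ord1.
  - rewrite (_ : past [::] j = if j is 0 then setT else set0); first by case: j.
    by apply/seteqP; split => w; rewrite /past /= big_ord0; case: j => // j [].
  case: j => [|j].
    rewrite mul1r add0n (_ : past [::] 0 = setT) ?setTI; first exact: rect.
    by apply/seteqP; split => w //; rewrite /past /= big_ord0.
  rewrite mul0r (_ : past [::] j.+1 = set0) ?set0I ?measure0 //.
  by apply/seteqP; split => w //; rewrite /past /= big_ord0 => -[].
rewrite size_rcons => cN; have [w [w0 wS mA wP]] := IH (ltnW cN).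
pose w' j := w j * (v a * F c a) +
  (if j is j'.+1 then \sum_b w j' * (v b * v a * (1 - F c b)) else 0).
exists w'; split.
- move=> j; rewrite /w' => h; rewrite w0 1?ltnW // mul0r add0r.
  case: j h => // j h; rewrite big1 // => b _; rewrite w0 ?mul0r //.
(* The weights vanish above [size c], so the shift by one in the rejection term loses nothing and
   the two sums combine into [thinning_density]. *)
- rewrite history_mass_rcons -wS /w' big_split /= big_ord_recr /=.
  rewrite (w0 (size c).+1) // mul0r addr0 [X in _ + X]big_ord_recl /= add0r.
  rewrite -big_split /= mulr_suml; apply: eq_bigr => j _.
  rewrite add0n /thinning_density !mulrDr; congr (_ + _).
  by rewrite !mulr_sumr; apply: eq_bigr => b _; ring.
- move=> j; rewrite past_rcons //; apply: measurableU.
    by apply: measurableI => //; apply: measurableI.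
  case: j => // j.
  by apply: (measure_big_setU P _ _).1 => b; do ! apply: measurableI => //.
move=> j s t tP; rewrite past_rcons // setIUl.
set A1 := past c j `&` _; set A2 := (if j is _.+1 then _ else _).
set G := future_cells D ((size c).+1 + j) s `&` future_thresholds U (size c).+1 t.
have mG : measurable G by apply: measurableI.
have mA1 : measurable A1 by do ! apply: measurableI => //.
have B1 : (P (A1 `&` G) <= (w j * (v a * F c a) *
    ((\prod_(a <- s) v a) * (\prod_(br <- t) threshold_mass br)))%:E)%E.
  (* The current candidate and its threshold are taken as the head of the future prescribed to the
     shorter past. A rejection, in [B2], consumes two candidates but one threshold. *)
  have := wP j (a :: s) ((true, F c a) :: t).
  rewrite /= F01 => /(_ tP); rewrite !big_cons => h.
  rewrite (_ : A1 `&` G = past c j `&`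
     (([set w | D (size c + j)%N w = a] `&` future_cells D (size c + j).+1 s)
     `&` ([set w0 | threshold_set (true, F c a) (U (size c) w0)]
       `&` future_thresholds U (size c).+1 t))).
    apply: le_trans h _; rewrite lee_fin /threshold_mass /=.
    by rewrite le_eqVlt; apply/orP; left; apply/eqP; ring.
  by rewrite /A1 /G addSn -setIA setIACA.
case: j @A1 @A2 @G mG mA1 B1 => [|j] A1 A2 G mG mA1 B1.
  by rewrite /A2 set0I setU0 /w' addr0.
have mA2 b : measurable (past c j `&` ([set w | D (size c + j)%N w = b]
        `&` [set w | D (size c + j.+1)%N w = a]
    `&` [set w | threshold_set (false, F c b) (U (size c) w)]) `&` G).
  by do ! apply: measurableI => //.
have B2 b : (P (past c j `&` ([set w | D (size c + j)%N w = b]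
        `&` [set w | D (size c + j.+1)%N w = a]
    `&` [set w | threshold_set (false, F c b) (U (size c) w)]) `&` G) <=
   (w j * (v b * v a * (1 - F c b)) *
    ((\prod_(a <- s) v a) * (\prod_(br <- t) threshold_mass br)))%:E)%E.
  have := wP j (b :: a :: s) ((false, F c b) :: t).
  rewrite /= F01 => /(_ tP); rewrite !big_cons => h.
  rewrite (_ : _ `&` G = past c j `&`
     (([set w | D (size c + j)%N w = b] `&` ([set w | D (size c + j).+1 w = a]
       `&` future_cells D (size c + j).+2 s))
     `&` ([set w0 | threshold_set (false, F c b) (U (size c) w0)]
       `&` future_thresholds U (size c).+1 t))).
    apply: le_trans h _; rewrite lee_fin /threshold_mass /=.
    by rewrite le_eqVlt; apply/orP; left; apply/eqP; ring.
  by rewrite /G addSn addnS -setIA setIACA (setIA [set w | D (size c + j)%N w = b]).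
have [mU2 PU2] := measure_big_setU P (index_enum C) mA2.
rewrite /A2 [X in _ `|` X](_ : _ = \big[setU/set0]_(b <- index_enum C)
  (past c j `&` ([set w | D (size c + j)%N w = b]
        `&` [set w | D (size c + j.+1)%N w = a]
    `&` [set w | threshold_set (false, F c b) (U (size c) w)]) `&` G)); last first.
  by rewrite -big_distrl.
apply: (le_trans (measureU2 _ (measurableI _ _ mA1 mG) mU2)).
rewrite /w' mulrDl EFinD; apply: leeD => //.
apply: le_trans PU2 _; rewrite mulr_suml -sumEFin.
by apply: lee_sum => b _; exact: B2.
Qed.

(** Sums [past_bound], with empty future, over the number of rejections, which is at most
    [size c]. *)
Lemma history_bound (c : seq C) : (size c <= N)%N ->
  measurable [set w | mkseq (z^~ w) (size c) = c] /\
  (P [set w | mkseq (z^~ w) (size c) = c] <=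
    (history_mass v (thinning_density v F) c)%:E)%E.
Proof.
move=> cN; have [w [w0 wS mA wP]] := past_bound cN.
have -> : [set w | mkseq (z^~ w) (size c) = c] =
    \big[setU/set0]_(j <- index_enum 'I_(size c).+1) past c j.
  apply/seteqP; split => x; rewrite -bigcup_seq /=.
    move=> h; have hj : (\sum_(i < size c) chi i x < (size c).+1)%N.
      rewrite ltnS -[X in (_ <= X)%N]card_ord -sum1_card.
      by apply: leq_sum => i _; exact: leq_b1.
    by exists (Ordinal hj) => //=; rewrite mem_index_enum.
  by move=> [j _ []].
have [m1 p1] := measure_big_setU P (index_enum 'I_(size c).+1) (fun j => mA (j : nat)).
split => //; apply: le_trans p1 _; rewrite -wS -sumEFin; apply: lee_sum => j _.
have := wP j [::] [::] isT; rewrite /= !big_nil !mulr1.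
by rewrite setIT setIT.
Qed.

End History.

(** * Independent uniform candidates and thresholds: the masses of cells and histories *)

Lemma independent_prefix (d1 d2 : measure_display) (T : measurableType d1)
    (S : measurableType d2) (R : realType) (P : probability T R)
    (Y : nat -> {RV P >-> S}) (B : nat -> set S) (n : nat) :
  mutually_independent Y -> (forall i, measurable (B i)) ->
  P (\bigcap_(i in `I_n) (Y i @^-1` B i)) = (\prod_(i < n) P (Y i @^-1` B i))%E.
Proof.
move=> mi mB; have := mi (seq_fset tt (iota 0 n)) B mB.
rewrite (perm_big _ (seq_fset_perm tt (iota 0 n))) (undup_id (iota_uniq 0 n)).
rewrite -[in X in _ = X -> _](subn0 n) -/(index_iota 0 n) big_mkord => <-.
congr (P _); apply: eq_bigcapl.
by split => i; have := seq_fsetE tt (iota 0 n) i; rewrite mem_iota /= add0n => ->.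
Qed.

Lemma sigma_of_prefix (d1 d2 : measure_display) (T : measurableType d1)
    (S : measurableType d2) (R : realType) (P : probability T R)
    (Y : nat -> {RV P >-> S}) (B : nat -> set S) (n : nat) :
  (forall i, measurable (B i)) ->
  sigma_of Y (\bigcap_(i in `I_n) (Y i @^-1` B i)).
Proof.
move=> mB; pose G := \bigcup_k preimage_set_system setT (Y k) measurable.
have : measurable (\bigcap_(i in `I_n) (Y i @^-1` B i) : set (g_sigma_algebraType G)).
  apply: bigcap_measurableType => i _; apply: sub_sigma_algebra.
  by exists i => //; exists (B i) => //; rewrite setTI.
by [].
Qed.

Lemma future_cellsE (T C : Type) (D : nat -> T -> C) (a0 : C) (k : nat) (s : seq C) (w : T) :
  future_cells D k s w <-> forall i, (i < size s)%N -> D (k + i)%N w = nth a0 s i.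
Proof.
elim: s k => [|a s IH] k /=; first by split.
split => [[h1 /IH h2] [|i] hi|h]; first by rewrite addn0.
  by rewrite addnS -addSn h2.
split; first by have := h 0%N isT; rewrite addn0.
by apply/IH => i hi; rewrite addSn -addnS h.
Qed.

Lemma future_thresholdsE (T : Type) (R : realType) (U : nat -> T -> R) (br0 : bool * R)
    (k : nat) (t : seq (bool * R)) (w : T) :
  future_thresholds U k t w <->
  forall i, (i < size t)%N -> threshold_set (nth br0 t i) (U (k + i)%N w).
Proof.
elim: t k => [|a s IH] k /=; first by split.
split => [[h1 /IH h2] [|i] hi|h]; first by rewrite addn0.
  by rewrite addnS -addSn; apply: h2.
split; first by have := h 0%N isT; rewrite addn0.
by apply/IH => i hi; rewrite addSn -addnS; exact: (h i.+1 hi).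
Qed.

Lemma measurable_threshold_set (R : realType) (br : bool * R) :
  measurable (threshold_set br : set (measurableTypeR R)).
Proof.
case: br => -[] r.
  rewrite (_ : threshold_set _ = `]-oo, r]%classic); first exact: measurable_itv.
  by apply/seteqP; split => x; rewrite /threshold_set /= in_itv.
rewrite (_ : threshold_set _ = `]r, +oo[%classic); first exact: measurable_itv.
by apply/seteqP; split => x; rewrite /threshold_set /= in_itv /= andbT.
Qed.

Lemma uniform_threshold (R : realType) (br : bool * R) : 0 <= br.2 <= 1 ->
  uniform_prob (@ltr01 R) (threshold_set br) = (threshold_mass br)%:E.
Proof.
case: br => b r /= /andP[r0 r1]; rewrite /uniform_prob integral_uniform_pdf.
have e : forall x, x \in threshold_set (b, r) `&` `[0, 1] ->
    ((uniform_pdf 0 1 x)%:E = 1%:E :> \bar R)%E.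
  move=> x /set_mem [_]; rewrite /= in_itv /= => h.
  by rewrite /uniform_pdf h subr0 invr1.
rewrite (eq_integral (fun=> 1%E)); last by move=> x; exact: e.
rewrite integral_cst; last first.
  by apply: measurableI; [exact: measurable_threshold_set | exact: measurable_itv].
rewrite mul1e /threshold_mass /=; case: b {e} => /=.
  rewrite (_ : _ `&` _ = `[0, r]%classic) ?lebesgue_measure_itv /= ?lte_fin.
    case: ltgtP r0 => // [r0 _|<- _]; last by [].
    by rewrite oppr0 adde0.
  apply/seteqP; split => x; rewrite /threshold_set /= !in_itv /=.
    by move=> [h /andP[-> _]].
  by move=> /andP[h1 h2]; split => //; rewrite h1 (le_trans h2).
rewrite (_ : _ `&` _ = `]r, 1]%classic) ?lebesgue_measure_itv /= ?lte_fin.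
  by case: ltgtP r1 => // -> _; rewrite subrr.
apply/seteqP; split => x; rewrite /threshold_set /= !in_itv /=.
  by move=> [h /andP[_ ->]]; rewrite h.
by move=> /andP[h1 h2]; split => //; rewrite h2 andbT (le_trans r0) // ltW.
Qed.

Lemma lebesgue_tuple0 (R : realType) (d : nat) :
  lebesgue_tuple (set0 : set (d.-tuple R)) = 0%E.
Proof.
elim: d => [|d IH] /=; first by rewrite indic0.
rewrite -[RHS](integral0 lebesgue_measure setT); apply: eq_integral => x _.
by rewrite -[RHS]IH; congr lebesgue_tuple; apply/seteqP; split.
Qed.

Lemma lebesgue_tuple_box (R : realType) (d : nat) (a b : d.-tuple R) :
  (forall i, tnth a i <= tnth b i) ->
  lebesgue_tuple (box a b) = (\prod_(i < d) (tnth b i - tnth a i))%:E.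
Proof.
elim: d a b => [|d IH] a b ab /=.
  rewrite big_ord0 indicE (_ : _ \in _ = true) //.
  by apply/mem_set => -[].
case/tupleP: a ab => a0 a; case/tupleP: b => b0 b ab.
have ab0 : a0 <= b0 by have := ab ord0; rewrite !tnth0.
have ab' i : tnth a i <= tnth b i by have := ab (lift ord0 i); rewrite !tnthS.
transitivity (\int[lebesgue_measure]_x
  ((\prod_(i < d) (tnth b i - tnth a i))%:E * (\1_`[a0, b0[%classic x)%:E))%E.
  apply: eq_integral => x _; rewrite indicE; case: (boolP (x \in _)) => [/set_mem|/negP hx].
    rewrite /= in_itv /= => hx; rewrite mule1 -IH //; congr lebesgue_tuple.
    apply/seteqP; split => y; rewrite /box /= => h i.
      by have := h (lift ord0 i); rewrite !tnthS.
    by case: (unliftP ord0 i) => [j ->|->]; rewrite ?tnthS ?tnth0.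
  rewrite mule0 -(lebesgue_tuple0 R d); congr lebesgue_tuple.
  apply/seteqP; split => y //=; rewrite /box /= => /(_ ord0).
  by rewrite !tnth0 => h; apply: hx; apply/mem_set; rewrite /= in_itv.
rewrite ge0_integralZl_EFin //; last 2 first.
- apply/measurable_realfun.measurable_EFinP; apply: measurable_realfun.measurable_indic.
  exact: measurable_itv.
- by apply: prodr_ge0 => i _; rewrite subr_ge0.
rewrite integral_indic; [|exact: measurableT|exact: measurable_itv].
have e : lebesgue_measure (`[a0, b0[%classic : set R) = (b0 - a0)%:E.
  rewrite lebesgue_measure_itv /= lte_fin.
  by case: ltgtP ab0 => // -> _; rewrite subrr.
rewrite setIT [X in (_ * X)%E](_ : _ = (b0 - a0)%:E); last exact: e.
rewrite big_ord_recl !tnth0 EFinM muleC; congr (_ * _)%E.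
by congr EFin; apply: eq_bigr => i _; rewrite !tnthS.
Qed.

Lemma cell1_inside (R : realType) (L : nat) (x : R) (j : 'I_(2 ^ L).+1) :
  (j < 2 ^ L)%N ->
  (cell1 L x == j) = (j%:R / 2 ^+ L <= x < j.+1%:R / 2 ^+ L).
Proof.
move=> jL; have p : (0 : R) < 2 ^+ L by apply: exprn_gt0.
rewrite ler_pdivrMr // ltr_pdivlMr // /cell1; case: ifPn => x01.
  have /andP[x0 x1] := x01.
  have h0 : 0 <= x * 2 ^+ L by rewrite mulr_ge0 // ltW.
  rewrite -(truncn_eq _ h0) mulrC -val_eqE /= inordK //.
  by rewrite mulrC ltnS ltnW // truncn_exp2_lt.
rewrite -val_eqE /= gtn_eqF //; apply/esym/negbTE; apply: contra x01.
move=> /andP[h1 h2]; apply/andP; split.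
  by rewrite -(pmulr_lge0 _ p) (le_trans _ h1).
by rewrite -(ltr_pM2r p) mul1r (lt_le_trans h2) // -natrX ler_nat.
Qed.

Lemma cell1_outside (R : realType) (L : nat) (x : R) (j : 'I_(2 ^ L).+1) :
  ~~ (j < 2 ^ L)%N -> (cell1 L x == j) = ~~ (0 <= x < 1).
Proof.
move=> jL; have -> : j = ord_max.
  by apply/val_inj/eqP; rewrite /= eqn_leq -ltnS ltn_ord leqNgt.
rewrite /cell1; case: ifPn => x01; last by rewrite eqxx.
have h := truncn_exp2_lt L x01.
by rewrite -val_eqE /= inordK ?ltn_eqF // ltnS ltnW.
Qed.

Lemma measurable_cell (R : realType) (d L : nat) (c : {ffun 'I_d -> 'I_(2 ^ L).+1}) :
  measurable ([set x | cell L x = c] : set (d.-tuple (measurableTypeR R))).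
Proof.
have m1 (j : 'I_(2 ^ L).+1) : measurable ([set x | cell1 L x = j] : set (measurableTypeR R)).
  have [jL|jL] := boolP (j < 2 ^ L)%N.
    rewrite (_ : [set x | _] = `[j%:R / 2 ^+ L, j.+1%:R / 2 ^+ L[%classic).
      exact: measurable_itv.
    by apply/seteqP; split => x /=; rewrite in_itv /= -cell1_inside // => /eqP.
  rewrite (_ : [set x | _] = ~` `[0, 1[%classic).
    by apply: measurableC; exact: measurable_itv.
  apply/seteqP; split => x /=; rewrite in_itv /=.
    by move=> /eqP; rewrite cell1_outside // => /negP.
  by move=> /negP; rewrite -(cell1_outside x jL) => /eqP.
rewrite (_ : [set x | _] = \bigcap_(i in [set: 'I_d])
   ((@tnth d (measurableTypeR R))^~ i @^-1` [set x | cell1 L x = c i])).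
  apply: fin_bigcap_measurable; first exact: finite_finset.
  by move=> i _; rewrite -[X in measurable X]setTI; apply: measurable_tnth.
apply/seteqP; split => x /=; first by move=> <- i _ /=; rewrite ffunE.
by move=> h; apply/ffunP => i; rewrite ffunE; apply: h.
Qed.

Lemma lebesgue_tuple_cell (R : realType) (d L : nat) (c : {ffun 'I_d -> 'I_(2 ^ L).+1}) :
  lebesgue_tuple ([set x | cell L x = c] `&` unit_cube R d) = (cell_mass R c)%:E.
Proof.
have p : (0 : R) < 2 ^+ L by apply: exprn_gt0.
(* A cell with an extra coordinate misses the cube and has mass 0; every other cell is a box of side
   2^-L. *)
have [h|] := boolP [forall i, (c i < 2 ^ L)%N]; last first.
  rewrite negb_forall => /existsP[i hi].
  rewrite /cell_mass (bigD1 i) //= (negbTE hi) !mul0r.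
  rewrite (_ : _ `&` _ = set0) ?lebesgue_tuple0 //.
  apply/seteqP; split => x //= -[] hx /(_ i).
  have : cell1 L (tnth x i) == c i by rewrite -hx ffunE.
  by rewrite cell1_outside // => /negP.
have {}h i : (c i < 2 ^ L)%N by apply/forallP: i.
pose a : d.-tuple R := [tuple (c i)%:R / 2 ^+ L | i < d].
pose b : d.-tuple R := [tuple (c i).+1%:R / 2 ^+ L | i < d].
have -> : [set x | cell L x = c] `&` unit_cube R d = box a b.
  apply/seteqP; split => x; rewrite /box /=.
    move=> [hx _] i; rewrite !tnth_mktuple -cell1_inside //.
    by rewrite -hx ffunE.
  move=> hx; have {}hx i : cell1 L (tnth x i) == c i.
    by have := hx i; rewrite !tnth_mktuple -cell1_inside.
  split => [|i]; first by apply/ffunP => i; rewrite ffunE; apply/eqP.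
  have := hx i; apply: contraTT => hn.
  by rewrite /cell1 (negbTE hn) -val_eqE /= gtn_eqF.
rewrite lebesgue_tuple_box => [|i]; last first.
  by rewrite !tnth_mktuple ler_pM2r ?invr_gt0 // ler_nat.
congr EFin; apply: eq_bigr => i _.
by rewrite !tnth_mktuple h -mulrBl -natrB // subSnn.
Qed.

Lemma prefix_bound (R : realType) (dT : measure_display) (T : measurableType dT)
    (P : probability T R) (d L : nat)
    (X : nat -> {RV P >-> d.-tuple (measurableTypeR R)})
    (U : nat -> {RV P >-> measurableTypeR R}) s t :
  (forall m, uniform_on_cube (X m)) -> mutually_independent X ->
  (forall n, uniform_on_itv01 (U n)) -> mutually_independent U ->
  independent_sequences X U ->
  all (fun br : bool * R => 0 <= br.2 <= 1) t ->
  P (future_cells (fun k w => cell L (X k w)) 0 s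
     `&` future_thresholds (fun k w => U k w) 0 t) =
  ((\prod_(a <- s) cell_mass R a) * (\prod_(br <- t) threshold_mass br))%:E.
Proof.
move=> uX iX uU iU iXU ht.
pose a0 : {ffun 'I_d -> 'I_(2 ^ L).+1} := [ffun=> ord0].
pose br0 : bool * R := (true, 0).
pose A i : set (d.-tuple (measurableTypeR R)) := [set x | cell L x = nth a0 s i].
pose B i : set (measurableTypeR R) := threshold_set (nth br0 t i).
have -> : future_cells (fun k w => cell L (X k w)) 0 s =
    \bigcap_(i in `I_(size s)) (X i @^-1` A i).
  apply/seteqP; split => w; first by move=> /(future_cellsE _ a0) h i hi; exact: h.
  by move=> h; apply/(future_cellsE _ a0) => i hi; exact: h.
have -> : future_thresholds (fun k w => U k w) 0 t =
    \bigcap_(i in `I_(size t)) (U i @^-1` B i).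
  apply/seteqP; split => w; first by move=> /(future_thresholdsE _ br0) h i hi; exact: h.
  by move=> h; apply/(future_thresholdsE _ br0) => i hi; exact: h.
have mA i : measurable (A i) by exact: measurable_cell.
have mB i : measurable (B i) by exact: measurable_threshold_set.
rewrite iXU; [|exact: sigma_of_prefix|exact: sigma_of_prefix].
rewrite !independent_prefix // EFinM; congr (_ * _)%E.
  rewrite (big_nth a0) big_mkord (big_morph EFin EFinM (erefl 1%E)).
  apply: eq_bigr => i _; rewrite -lebesgue_tuple_cell.
  exact: (uX i (A i) (mA i)).
rewrite (big_nth br0) big_mkord (big_morph EFin EFinM (erefl 1%E)).
apply: eq_bigr => i _; rewrite -uniform_threshold; first exact: (uU i (B i) (mB i)).
by move/(all_nthP br0): ht; apply.
Qed.

(** The successor is the shift in lambda_n, which governs the n-th point given the n - 1 earlier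
    ones. *)
Definition cell_density (R : realType) (d L : nat) (beta : R)
    (c : seq {ffun 'I_d -> 'I_(2 ^ L).+1}) (a : {ffun 'I_d -> 'I_(2 ^ L).+1}) : R :=
  haar_density beta (size c).+1 (map (rep R (L := L)) c) (rep R a).

Lemma haar_history_bound (R : realType) (dT : measure_display)
    (T : measurableType dT) (P : probability T R) (d L : nat) (beta : R)
    (X : nat -> {RV P >-> d.-tuple (measurableTypeR R)})
    (U : nat -> {RV P >-> measurableTypeR R})
    (chi : nat -> T -> bool) (Z : nat -> T -> d.-tuple R)
    (c : seq {ffun 'I_d -> 'I_(2 ^ L).+1}) :
  (0 < d)%N -> 0 <= beta <= 1 ->
  (forall m, uniform_on_cube (X m)) -> mutually_independent X ->
  (forall n, uniform_on_itv01 (U n)) -> mutually_independent U ->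
  independent_sequences X U ->
  (forall w, thinning (haar_strategy beta)
    (fun m => X m w) (fun n => U n w) (fun n => chi n w) (fun n => Z n w)) ->
  (trunc_log 2 (size c) <= L)%N ->
  measurable [set w | mkseq (fun i => cell L (Z i w)) (size c) = c] /\
  (P [set w | mkseq (fun i => cell L (Z i w)) (size c) = c] <=
    (history_mass (cell_mass R (L := L)) (cell_density beta) c)%:E)%E.
Proof.
move=> d0 b01 uX iX uU iU iXU thin cL; set N := size c.
have /andP[b0 b1] := b01.
pose F (s : seq {ffun 'I_d -> 'I_(2 ^ L).+1}) a : R := cell_density beta s a - beta / 2.
have -> : history_mass (cell_mass R (L := L)) (cell_density beta) c =
    history_mass (cell_mass R (L := L)) (thinning_density (cell_mass R (L := L)) F) c.
  elim/last_ind: c @N cL => // c a IH N; rewrite size_rcons => cL.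
  rewrite !history_mass_rcons -IH; last first.
    by apply: leq_trans cL; exact: leq_trunc_log.
  congr (_ * (_ * _)); rewrite /thinning_density.
  (* The density has mean 1, so a candidate is rejected with mean probability beta / 2. This is
     exactly what the strategy subtracts, and [thinning_density] restores the density. *)
  rewrite (eq_bigr (fun b => cell_mass R b * (1 + beta / 2) -
      cell_mass R b * haar_density beta (size c).+1 (map (rep R (L := L)) c) (rep R b))).
    by rewrite sumrB -mulr_suml sum_cell_mass sum_cell_density // /F; ring.
  by move=> b _; rewrite /F /cell_density; ring.
have mX : forall k a, measurable [set w | cell L (X k w) = a].
  move=> k a; exact: (measurable_funPTI (X k) (measurable_cell a)).
have mU : forall k br, measurable [set w | threshold_set br (U k w)].
  move=> k br; exact: (measurable_funPTI (U k) (measurable_threshold_set br)).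
apply: (@history_bound dT T R P _ (fun k w => cell L (X k w)) (fun k w => U k w)
  (cell_mass R (L := L)) F N chi (fun i w => cell L (Z i w))) => //.
(* The density is within beta / 2 of 1, so [F] lies between 1 - beta and 1. *)
- move=> s a; have /andP[h1 h2] :=
    haar_density_bounds (size s).+1 (map (rep R (L := L)) s) (rep R a) d0 b0.
  rewrite /F /cell_density; apply/andP; split; lra.
- by move=> s t ht; rewrite (prefix_bound s uX iX uU iU iXU ht).
- move=> n w nN; have [-> _] := thin w n; congr (_ < _).
  rewrite /haar_strategy /F /cell_density !size_mkseq; congr (_ - _).
  have -> : mkseq (fun i => cell L (Z i w)) n = map (cell L) (mkseq (fun i => Z i w) n).
    by rewrite /mkseq -map_comp.
  rewrite -map_comp haar_density_cell //.
  by apply: leq_trans cL; exact: leq_trunc_log.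
- by move=> n w; have [_ ->] := thin w n.
Qed.

(** * Exponential moments over histories *)

Fixpoint histories (C : finType) (n : nat) : seq (seq C) :=
  if n is n'.+1 then [seq rcons c a | c <- histories C n', a <- enum C]
  else [:: [::]].

Lemma mem_histories (C : finType) (n : nat) (c : seq C) :
  (c \in histories C n) = (size c == n).
Proof.
elim: n c => [|n IH] c /=; first by rewrite inE; case: c.
apply/allpairsP/eqP => [[[c' a] /= [h _ ->]]|].
  by rewrite size_rcons; move: h; rewrite IH => /eqP ->.
case/lastP: c => // c a; rewrite size_rcons => -[h].
by exists (c, a); rewrite /= IH h mem_enum.
Qed.

Lemma sum_historiesS (R : realType) (C : finType) (v : C -> R)
    (lam : seq C -> C -> R) (n : nat) (g : seq C -> R) :
  \sum_(c <- histories C n.+1) history_mass v lam c * g c =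
  \sum_(c <- histories C n) history_mass v lam c *
    \sum_a v a * lam c a * g (rcons c a).
Proof.
rewrite /= big_allpairs_dep; apply: eq_bigr => c _.
rewrite mulr_sumr big_enum /=; apply: eq_bigr => a _.
by rewrite history_mass_rcons !mulrA.
Qed.

Lemma history_mass_ge0 (R : realType) (C : finType) (v : C -> R)
    (lam : seq C -> C -> R) (c : seq C) :
  (forall a, 0 <= v a) -> (forall c a, 0 <= lam c a) -> 0 <= history_mass v lam c.
Proof.
move=> v0 l0; elim/last_ind: c => [|c a IH]; first exact: ler01.
by rewrite history_mass_rcons !mulr_ge0.
Qed.

Lemma sum_history_mass (R : realType) (C : finType) (v : C -> R)
    (lam : seq C -> C -> R) (n : nat) :
  (forall c, (size c < n)%N -> \sum_a v a * lam c a = 1) ->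
  \sum_(c <- histories C n) history_mass v lam c = 1.
Proof.
elim: n => [|n IH] h; first by rewrite big_seq1.
rewrite -IH => [|c cn]; last by rewrite h // ltnW.
under eq_bigr => c _ do rewrite -[history_mass _ _ _]mulr1.
rewrite sum_historiesS; apply: eq_big_seq => c.
rewrite mem_histories => /eqP cn.
by under eq_bigr do rewrite mulr1; rewrite h ?cn // mulr1.
Qed.

(* [Phi] may grow geometrically during the first [K] steps only; afterwards its drift
   is at most [gamma]. *)
Lemma moment_bound (R : realType) (C : finType) (v : C -> R)
    (lam : seq C -> C -> R) (Phi : seq C -> R) (n K : nat) (alpha gamma : R) :
  (forall a, 0 <= v a) -> (forall c a, 0 <= lam c a) ->
  (forall c, (size c < n)%N -> \sum_a v a * lam c a = 1) ->
  1 <= alpha -> 0 <= gamma -> (forall c, 0 <= Phi c) ->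
  (forall c, (size c < n)%N -> \sum_a v a * lam c a * Phi (rcons c a) <=
     (if (size c < K)%N then alpha else 1) * Phi c + gamma) ->
  \sum_(c <- histories C n) history_mass v lam c * Phi c <=
    alpha ^+ K * (Phi [::] + n%:R * gamma).
Proof.
move=> v0 l0 sv a1 g0 P0 step.
have a0 : 0 <= alpha by apply: le_trans a1.
suff h : forall m, (m <= n)%N ->
    \sum_(c <- histories C m) history_mass v lam c * Phi c <=
    alpha ^+ (minn m K) * (Phi [::] + m%:R * gamma).
  apply: le_trans (h n (leqnn n)) _; apply: ler_wpM2r.
    by rewrite addr_ge0 // mulr_ge0.
  by rewrite ler_weXn2l // geq_minr.
elim=> [_|m IH mn]; first by rewrite big_seq1 min0n expr0 mul0r addr0 !mul1r.
pose k : R := if (m < K)%N then alpha else 1.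
have k0 : 0 <= k by rewrite /k; case: ifP.
have kE : k * alpha ^+ (minn m K) = alpha ^+ (minn m.+1 K).
  rewrite /k; case: ltnP => h; last by rewrite mul1r !(minn_idPr _) // (leq_trans h).
  by rewrite -exprS !(minn_idPl _) // ltnW.
rewrite sum_historiesS.
apply: (@le_trans _ _ (\sum_(c <- histories C m)
    (k * (history_mass v lam c * Phi c) + gamma * history_mass v lam c))).
  rewrite big_seq [leRHS]big_seq; apply: ler_sum => c.
  rewrite mem_histories => /eqP cm.
  apply: le_trans (ler_wpM2l (history_mass_ge0 _ v0 l0) (step c _)) _; rewrite ?cm //.
  by rewrite -/k le_eqVlt; apply/orP; left; apply/eqP; ring.
rewrite big_split /= -!mulr_sumr sum_history_mass => [|c cm]; last first.
  by rewrite sv // (ltn_trans cm).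
apply: le_trans (lerD (ler_wpM2l k0 (IH (ltnW mn))) (lexx _)) _.
rewrite mulrA kE mulr1 -natr1 mulrDl mul1r addrA [leRHS]mulrDr lerD2l.
by rewrite ler_peMl // exprn_ege1.
Qed.

Lemma history_markov (R : realType) (C : finType) (v : C -> R)
    (lam : seq C -> C -> R) (Phi : seq C -> R) (bad : pred (seq C)) (n : nat) (M : R) :
  (forall a, 0 <= v a) -> (forall c a, 0 <= lam c a) -> (forall c, 0 <= Phi c) ->
  0 < M -> (forall c, bad c -> M <= Phi c) ->
  \sum_(c <- histories C n | bad c) history_mass v lam c <=
  (\sum_(c <- histories C n) history_mass v lam c * Phi c) / M.
Proof.
move=> v0 l0 P0 M0 h; rewrite ler_pdivlMr // mulr_suml big_mkcond /=.
apply: ler_sum => c _; have r0 := history_mass_ge0 c v0 l0.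
by case: ifP => [/h hc|_]; [exact: ler_wpM2l | exact: mulr_ge0].
Qed.

(** The quantities are cosh t - 1 and sinh t. With x = e^t and y = e^(-t) they equal (x - 1)^2 y / 2
    and (x - 1) (x + 1) y / 2, so the last inequality reduces to x - 1 <= 2 t (x + 1). *)
Lemma expR_pair_bounds (R : realType) (t : R) : 0 <= t <= 1 / 2 ->
  [/\ 0 <= (expR t + expR (- t)) / 2 - 1 <= 1,
      0 <= (expR t - expR (- t)) / 2 <= 1 &
      (expR t + expR (- t)) / 2 - 1 <= 2 * t * ((expR t - expR (- t)) / 2)].
Proof.
move=> /andP[t0 t1].
have x0 := expR_gt0 t; have hx := expR_ge1Dx t; have hy := expR_ge1Dx (- t).
have xy : expR t * expR (- t) = 1 by rewrite -expRD subrr expR0.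
set x := expR t in x0 hx xy *; set y := expR (- t) in hy xy *.
have x1 : 1 <= x by lra.
have y0 : 0 < y by lra.
have y1 : y <= 1 by rewrite -xy ler_peMl // ltW.
have x2 : x <= 2 by nra.
have xy2 : 2 <= x + y by nra.
split; [apply/andP; split; lra | apply/andP; split; lra |].
have h : x - 1 <= 2 * t * (x + 1) by nra.
have h2 : (x - 1) * (x - 1) <= 2 * t * (x + 1) * (x - 1).
  by apply: ler_wpM2r => //; rewrite subr_ge0.
have e1 : (x + y) / 2 - 1 = (x - 1) * (x - 1) * y / 2.
  have -> : (x - 1) * (x - 1) * y = x * (x * y) - 2 * (x * y) + y by ring.
  by rewrite xy; field.
have e2 : 2 * t * ((x - y) / 2) = 2 * t * (x + 1) * (x - 1) * y / 2.
  have -> : 2 * t * (x + 1) * (x - 1) * y = 2 * t * (x * (x * y) - y) by ring.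
  by rewrite xy; field.
rewrite e1 e2; apply: ler_wpM2r; first lra.
by apply: ler_wpM2r => //; exact: ltW.
Qed.

(** The addition formula for cosh. As xi is 0, 1 or -1, its factors are affine in |xi| and linear in
    xi, so averaging it needs only the means of these two. *)
Lemma expR_step (R : realType) (t S xi : R) : xi \in [:: 0; 1; -1] ->
  expR (t * (S + xi)) + expR (- (t * (S + xi))) =
  (expR (t * S) + expR (- (t * S))) *
     (1 + `|xi| * ((expR t + expR (- t)) / 2 - 1)) +
  (expR (t * S) - expR (- (t * S))) * (xi * ((expR t - expR (- t)) / 2)).
Proof.
rewrite !inE => /or3P[] /eqP ->.
- by rewrite addr0 normr0; ring.
- by rewrite normr1 mulrDr mulr1 opprD !expRD; field.
- by rewrite normrN1 mulrDr mulrN1 opprD opprK !expRD; field.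
Qed.

(** Both sides vanish at S = 0; otherwise the smaller of the two exponentials is at most 1. The
    constant 2 becomes the additive gain per step in [haar_moment]. *)
Lemma expR_sg (R : realType) (t S : R) : 0 < t ->
  expR (t * S) + expR (- (t * S)) - 2 <=
  (expR (t * S) - expR (- (t * S))) * Num.sg S.
Proof.
move=> t0; case: (sgrP S) => [->|S0|S0].
- by rewrite mulr0 oppr0 expR0; lra.
- have : expR (- (t * S)) <= 1 by rewrite expR_le1 oppr_le0 mulr_ge0 // ltW.
  lra.
- have : expR (t * S) <= 1 by rewrite expR_le1 pmulr_rle0 // ltW.
  lra.
Qed.

Lemma haar_W_homo (d : nat) : {homo haar_W d : s t / (s <= t)%N}.
Proof.
move=> s t st; rewrite /haar_W [leqRHS](big_cat_nat _ (n := s.+1)) //=.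
by rewrite leq_addr.
Qed.

Lemma haar_W_gt0 (d s : nat) : (0 < d)%N -> (0 < s)%N -> (0 < haar_W d s)%N.
Proof.
move=> d0 s0; apply: leq_trans (haar_W_homo d s0).
by rewrite /haar_W big_nat1 bin_gt0; lia.
Qed.

Lemma pairing_rcons (R : realType) (d : nat) (nu : seq (d.-tuple R))
    (x : d.-tuple R) (F : d.-tuple R -> R) :
  pairing (rcons nu x) F = pairing nu F + F x.
Proof. by rewrite /pairing -cats1 big_cat big_seq1. Qed.

Lemma expR_nat_ge (R : realType) (n : nat) : (2 ^+ n : R) <= expR n%:R.
Proof.
elim: n => [|n IH]; first by rewrite expR0.
rewrite -[n.+1%:R]natr1 expRD exprSr ler_pM ?exprn_ge0 //.
by have := expR_ge1Dx (1 : R); lra.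
Qed.

Lemma expr_1D_le_expR (R : realType) (x : R) (n : nat) : 0 <= x ->
  (1 + x) ^+ n <= expR (x * n%:R).
Proof.
move=> x0; elim: n => [|n IH]; first by rewrite mulr0 expR0.
rewrite -[n.+1%:R]natr1 mulrDr mulr1 expRD exprSr ler_pM ?exprn_ge0 ?addr_ge0 //.
exact: expR_ge1Dx.
Qed.

(** * Moments of S and N for one Haar function of order k *)

Section HaarMoments.
Context (R : realType) (d L n : nat) (beta : R) (J : d.-tuple (int * int)) (k : nat).
Hypothesis d0 : (0 < d)%N.
Hypothesis beta01 : 0 < beta <= 1.
Hypothesis nL : (trunc_log 2 n <= L)%N.
Hypothesis vJ : forall i, haar_valid R (tnth J i).
Hypothesis hJ : forall i, (tnth J i).2 + 1 <= L%:Z.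
Hypothesis oJ : haar_order J = k%:Z.
Hypothesis k0 : (0 < k)%N.

Let cell_type := {ffun 'I_d -> 'I_(2 ^ L).+1}.
Let v : cell_type -> R := cell_mass R (L := L).
Let lam : seq cell_type -> cell_type -> R := cell_density beta.
Let p := haar_mass R J.
Let S (c : seq cell_type) : R := pairing (map (rep R (L := L)) c) (haar J).
Let N (c : seq cell_type) : R := pairing (map (rep R (L := L)) c) (fun x => `|haar J x|).

Let v_ge0 a : 0 <= v a. Proof. exact: cell_mass_ge0. Qed.

Let beta_ge0 : 0 <= beta. Proof. by case/andP: beta01 => /ltW. Qed.

Let lam_ge0 c a : 0 <= lam c a.
Proof.
have /andP[h _] := haar_density_bounds (size c).+1 (map (rep R (L := L)) c) (rep R a) d0 beta_ge0.
apply: le_trans h; case/andP: beta01 => _ b1; lra.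
Qed.

Let log_size (c : seq cell_type) : (size c < n)%N -> (trunc_log 2 (size c).+1 <= L)%N.
Proof. by move=> h; apply: leq_trans nL; exact: leq_trunc_log. Qed.

Let sum_lam c : (size c < n)%N -> \sum_a v a * lam c a = 1.
Proof. by move=> h; apply: sum_cell_density; exact: log_size. Qed.

Let q c : R := \sum_a v a * lam c a * `|haar J (rep R a)|.

Let q_le c : 0 <= q c <= 3 / 2 * p.
Proof.
apply/andP; split; first by apply: sumr_ge0 => a _; rewrite !mulr_ge0.
apply: sum_cell_density_norm_haar => //.
by rewrite beta_ge0; case/andP: beta01.
Qed.

Let sum_q c e : (size c < n)%N ->
  \sum_a v a * lam c a * (1 + `|haar J (rep R a)| * e) = 1 + q c * e.
Proof.
move=> cn; under eq_bigr => a _ do rewrite mulrDr mulr1 mulrA.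
by rewrite big_split /= sum_lam // -mulr_suml.
Qed.

Let p01 : 0 <= p <= 1. Proof. by rewrite haar_mass_ge0 haar_mass_le1. Qed.

(** No drift enters: [moment_bound] with [K = n] allows a factor 1 + 9 p / 2 at each step, and p n
    <= p 2^k <= 2^d by [haar_mass_order]. *)
Lemma count_moment : (n <= 2 ^ k)%N ->
  \sum_(c <- histories cell_type n) history_mass v lam c * expR (N c) <=
  expR (5 * 2 ^+ d).
Proof.
(* From e^(-1/2) >= 1/2 follow e^(1/2) <= 2 and e <= 4. *)
move=> nk; have e4 : expR (1 : R) - 1 <= 3.
  have x0 := expR_gt0 (1 / 2 : R); have y0 := expR_ge1Dx (- (1 / 2) : R).
  have xy : expR (1 / 2 : R) * expR (- (1 / 2)) = 1 by rewrite -expRD subrr expR0.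
  have e : (1 : R) = 1 / 2 + 1 / 2 by field.
  by rewrite [X in expR X]e expRD; nra.
(* 9/2 is 3/2, from the bound on the density, times 3, from e - 1 <= 3. *)
pose alpha : R := 1 + 9 / 2 * p.
have /andP[p0 p1] := p01.
have a1 : 1 <= alpha by rewrite lerDl mulr_ge0 // divr_ge0.
have : \sum_(c <- histories cell_type n) history_mass v lam c * expR (N c) <=
    alpha ^+ n * (expR (N [::]) + n%:R * 0).
  apply: moment_bound => // c cn.
  rewrite cn addr0.
  have -> : \sum_a v a * lam c a * expR (N (rcons c a)) =
      expR (N c) * (1 + q c * (expR 1 - 1)).
    rewrite -sum_q // mulr_sumr.
    apply: eq_bigr => a _; rewrite /N map_rcons pairing_rcons expRD.
    have := haar_values J (rep R a); rewrite !inE => /or3P[] /eqP->.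
    - by rewrite normr0 expR0; ring.
    - by rewrite normr1; ring.
    - by rewrite normrN1; ring.
  rewrite mulrC ler_pM2r ?expR_gt0 // lerD2l.
  have /andP[h1 h2] := q_le c.
  have e0 : 0 <= expR (1 : R) - 1 by have := expR_ge1Dx (1 : R); lra.
  by nra.
move=> h; apply: le_trans h _.
rewrite mulr0 addr0 /N /pairing big_nil expR0 mulr1.
apply: le_trans (expr_1D_le_expR _ _) _; first by rewrite mulr_ge0 // divr_ge0.
rewrite ler_expR; have hp := haar_mass_order vJ oJ.
have : p * n%:R <= 2 ^+ d.
  apply: le_trans hp; rewrite ler_wpM2l // -natrX ler_nat //.
have h2 : (0 : R) <= 2 ^+ d by apply: exprn_ge0.
by lra.
Qed.

(* At step i + 1 the mean of the increment of S is - sg S * p * delta, with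
   delta = beta / (2 W(h(i + 1))) >= 3 theta, which beats the second-order term
   because cosh theta - 1 <= 2 theta sinh theta. Before step 2^k the function
   [haar J] does not yet occur in the density and S is a martingale. *)
Let theta : R := beta / (6 * (haar_W d (trunc_log 2 n))%:R).

Lemma haar_moment : (k <= trunc_log 2 n)%N ->
  \sum_(c <- histories cell_type n) history_mass v lam c *
     (expR (theta * S c) + expR (- (theta * S c))) <=
  expR (5 * 2 ^+ d) * (2 + n%:R * 2).
Proof.
move=> kn; have /andP[b0 b1] := beta01; have /andP[p0 p1] := p01.
have W1 : 1 <= (haar_W d (trunc_log 2 n))%:R :> R.
  by rewrite ler1n haar_W_gt0 // (leq_trans k0).
set W := (haar_W d (trunc_log 2 n))%:R in W1.
have t0 : 0 < theta by rewrite divr_gt0 // mulr_gt0 // (lt_le_trans ltr01).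
have t1 : theta <= 1 / 2.
  by rewrite /theta -/W ler_pdivrMr ?mulr_gt0 ?(lt_le_trans ltr01) //; lra.
have [] := @expR_pair_bounds R theta; first by rewrite (ltW t0).
pose A := (expR theta + expR (- theta)) / 2 - 1.
pose B := (expR theta - expR (- theta)) / 2; rewrite -/A -/B.
move=> /andP[A0 A1] /andP[B0 B1] AB.
(* The growth factor of the martingale phase: q <= 3 p / 2 and cosh theta - 1 <= 1. *)
pose alpha : R := 1 + 3 / 2 * p.
have a1 : 1 <= alpha by rewrite lerDl mulr_ge0 // divr_ge0.
pose Phi c : R := expR (theta * S c) + expR (- (theta * S c)).
have Phi0 c : 0 <= Phi c by rewrite addr_ge0 ?expR_ge0.
have : \sum_(c <- histories cell_type n) history_mass v lam c * Phi c <=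
    alpha ^+ (2 ^ k) * (Phi [::] + n%:R * 2).
  apply: moment_bound => // c cn.
  pose m := \sum_a v a * lam c a * haar J (rep R a).
  have -> : \sum_a v a * lam c a * Phi (rcons c a) =
      Phi c * (1 + q c * A) +
      (expR (theta * S c) - expR (- (theta * S c))) * (m * B).
    rewrite -sum_q // /m [X in _ + _ * X]mulr_suml [X in X + _]mulr_sumr.
    rewrite [X in _ + X]mulr_sumr -big_split /=.
    apply: eq_bigr => a _; rewrite /Phi /S map_rcons pairing_rcons.
    by rewrite expR_step ?haar_values // -/A -/B; ring.
  have /andP[q0 q1] := q_le c.
  have qA : q c * A <= 3 / 2 * p * A by rewrite ler_wpM2r.
  have := sum_cell_density_haar beta (map (rep R (L := L)) c) (log_size cn) vJ hJ.
  rewrite oJ lez_nat -/(cell_density beta) => /(_ k0) mE.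
  have {}mE : m = if (k <= trunc_log 2 (size c).+1)%N then
     - (beta / (2 * (haar_W d (trunc_log 2 (size c).+1))%:R)
       * Num.sg (S c) * p) else 0 by rewrite -mE; apply: eq_bigr.
  rewrite mE {mE}; case: ifPn => kc.
    set W' := (haar_W d (trunc_log 2 (size c).+1))%:R.
    have W'1 : 1 <= W' :> R by rewrite ler1n haar_W_gt0 // (leq_trans k0).
    have W'W : W' <= W by rewrite ler_nat haar_W_homo // leq_trunc_log.
    set delta := beta / (2 * W').
    have dt : 3 * theta <= delta.
      have -> : 3 * theta = beta / (2 * W) by rewrite /theta -/W; field; lra.
      rewrite ler_pM2l // lef_pV2 ?posrE; lra.
    have d1 : delta <= 1 / 2 by rewrite ler_pdivrMr; lra.
    have Sg := expR_sg (S c) t0.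
    (* A <= 2 theta B turns 3/2 into 3 theta, which is beta / (2 W): this fixes the 6 in [theta]. *)
    have hA : 3 / 2 * p * A <= delta * p * B.
      have h1 : 3 / 2 * A <= delta * B.
        by have := ler_wpM2r B0 dt; lra.
      by have := ler_wpM2l p0 h1; lra.
    have de0 : 0 <= delta by lra.
    have pB0 : 0 <= p * B by apply: mulr_ge0.
    have dB : 0 <= delta * p * B by rewrite -mulrA; apply: mulr_ge0.
    have dB1 : delta * p * B <= 1.
      rewrite -mulrA; apply: mulr_ile1 => //; first lra.
      by apply: mulr_ile1.
    have E1 : Phi c * (1 + q c * A) <= Phi c * (1 + delta * p * B).
      by rewrite ler_wpM2l // lerD2l (le_trans qA).
    (* By [expR_sg] the drift takes back the whole increase of Phi in [E1] except 2 delta p B, which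
       is at most 2. *)
    have E2 : delta * p * B * (Phi c - 2) <=
        delta * p * B * ((expR (theta * S c) - expR (- (theta * S c))) * Num.sg (S c)).
      by rewrite ler_wpM2l.
    have E3 : Phi c <= (if (size c < 2 ^ k)%N then alpha else 1) * Phi c.
      by case: ifP; rewrite ?mul1r // ler_peMl.
    lra.
  (* Here k exceeds h([size c] + 1), so [size c < 2 ^ k] and the factor alpha is still allowed. *)
  rewrite mul0r mulr0 addr0 ifT; last first.
    move: kc; rewrite -ltnNge => h; rewrite ltnNge; apply/negP => h2.
    move: h; apply/negP; rewrite -leqNgt trunc_log_max //.
    exact: leq_trans h2 _.
  apply: (@le_trans _ _ (alpha * Phi c)); last by rewrite lerDl.
  rewrite mulrC ler_wpM2r // lerD2l (le_trans qA) //.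
  by rewrite ler_piMr // mulr_ge0 // divr_ge0.
move=> h; apply: le_trans h _.
have -> : Phi [::] = 2 by rewrite /Phi /S /pairing big_nil mulr0 oppr0 expR0.
rewrite ler_wpM2r ?addr_ge0 ?mulr_ge0 //.
apply: le_trans (expr_1D_le_expR _ _) _; first by rewrite mulr_ge0 // divr_ge0.
rewrite ler_expR natrX; have := haar_mass_order vJ oJ; rewrite -/p.
have h2 : (0 : R) <= 2 ^+ d by apply: exprn_ge0.
by lra.
Qed.

End HaarMoments.

(* On each dyadic interval of length 2^-k, [staircase k b] is the average of the
   indicator function of [0, b); its increments in k are single Haar functions. *)
Definition staircase (R : realType) (k : nat) (b x : R) : R :=
  Num.max 0 (Num.min (2 ^+ k * b - (Num.truncn (2 ^+ k * x))%:R) 1).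

(** * Haar approximation of intervals and boxes *)

Lemma staircase_bounds (R : realType) (k : nat) (b x : R) : 0 <= staircase k b x <= 1.
Proof. by rewrite /staircase le_max lexx ge_max ler01 ge_min lexx orbT. Qed.

Lemma staircase_homo (R : realType) (k : nat) (a b x : R) :
  a <= b -> staircase k a x <= staircase k b x.
Proof.
move=> ab; have h : 2 ^+ k * a <= 2 ^+ k * b :> R by rewrite ler_pM2l ?exprn_gt0.
rewrite /staircase ge_max !le_max lexx /=; apply/orP; right.
by rewrite le_min !ge_min lexx orbT andbT lerD2r h.
Qed.

Lemma staircase0 (R : realType) (b x : R) : 0 <= b <= 1 -> 0 <= x < 1 ->
  staircase 0 b x = b.
Proof.
move=> /andP[b0 b1] /andP[x0 x1]; rewrite /staircase expr0 !mul1r.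
have -> : Num.truncn x = 0%N by apply/eqP; rewrite truncn_eq ?x0.
by rewrite subr0 min_l // max_r.
Qed.

Lemma staircase_le (R : realType) (k : nat) (b x : R) :
  2 ^+ k * b <= (Num.truncn (2 ^+ k * x))%:R -> staircase k b x = 0.
Proof.
move=> h; rewrite /staircase; apply: max_l; rewrite ge_min; apply/orP; left; lra.
Qed.

Lemma staircase_ge (R : realType) (k : nat) (b x : R) :
  (Num.truncn (2 ^+ k * x)).+1%:R <= 2 ^+ k * b -> staircase k b x = 1.
Proof.
rewrite -natr1 => h; rewrite /staircase min_r ?max_r //; lra.
Qed.

Lemma divn2_eq (j m : nat) : (j %/ 2)%N = m -> j = m.*2 \/ j = m.*2.+1.
Proof. lia. Qed.

(** Only the level-k interval containing b changes. If f is the fraction of it to the left of b, its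
    halves have the averages min(2f, 1) and max(2f - 1, 0), that is f plus or minus min(f, 1 -
    f). *)
Lemma staircase_step (R : realType) (k : nat) (b : R) : 0 <= b <= 1 ->
  exists c I, [/\ haar_valid R I, I.2 + 1 = k.+1%:Z, 0 <= c <= 1 / 2 &
    forall x, 0 <= x < 1 -> staircase k.+1 b x = staircase k b x + c * haar1 I x].
Proof.
move=> /andP[b0 b1]; have p n : (0 : R) < 2 ^+ n by apply: exprn_gt0.
have [b_lt1|b_ge1] := ltP b 1; last first.
  (* The point b = 1 lies in no dyadic interval of [0, 1) and all the averages are 1: a zero
     coefficient on an arbitrary interval will do. *)
  have -> : b = 1 by apply/eqP; rewrite eq_le b1.
  exists 0, (0%N%:Z, k%:Z); split => //.
  - by apply/haar_validP; right; exists 0%N, k; rewrite expn_gt0.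
  - by rewrite /=; lia.
  - by apply/andP; split; lra.
  - move=> x x01; have h m := truncn_exp2_lt m x01.
    have e m : staircase m 1 x = 1 by apply: staircase_ge; rewrite mulr1 -[leRHS]natrX ler_nat.
    by rewrite mul0r addr0 !e.
set s := 2 ^+ k * b; have s0 : 0 <= s by rewrite mulr_ge0 // ltW.
have /andP[ms sm] := truncn_itv s0; set m := Num.truncn s in ms sm.
have mk : (m < 2 ^ k)%N by apply: truncn_exp2_lt; rewrite b0.
have sm1 : s < m%:R + 1 by rewrite natr1.
exists (Num.min (s - m%:R) (1 - (s - m%:R))), (m%:Z, k%:Z); split.
- by apply/haar_validP; right; exists m, k.
- by rewrite /=; lia.
- by rewrite /Num.min; case: ifP => h; apply/andP; split; move: h; lra.
move=> x x01; have x0 : 0 <= x by case/andP: x01.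
rewrite haar1_nat // x01.
have ei := truncn_exp2_div (leqnSn k) x0; rewrite subSnn expn1 in ei.
set j := Num.truncn (2 ^+ k.+1 * x) in ei *.
have s2 : 2 ^+ k.+1 * b = 2 * s by rewrite exprS mulrA.
have [im|mi|im] := ltngtP (j %/ 2)%N m.
- have jm : (j < m.*2)%N by rewrite -muln2 -ltn_divLR.
  have -> : staircase k b x = 1.
    by apply: staircase_ge; apply: le_trans ms; rewrite ei ler_nat.
  have -> : staircase k.+1 b x = 1.
    apply: staircase_ge; rewrite -/j s2; apply: (@le_trans _ _ (m.*2%:R)).
      by rewrite ler_nat.
    by rewrite -mul2n natrM ler_pM2l.
  by rewrite (ltn_eqF jm) (ltn_eqF (leqW jm)) subrr mulr0 addr0.
- have jm : (m.+1.*2 <= j)%N by rewrite -muln2 -leq_divRL.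
  have -> : staircase k b x = 0.
    by apply: staircase_le; apply: le_trans (ltW sm) _; rewrite ei ler_nat.
  have -> : staircase k.+1 b x = 0.
    apply: staircase_le; rewrite -/j s2; apply: (@le_trans _ _ (m.+1.*2%:R)).
      by rewrite -mul2n natrM ler_pM2l // ltW.
    by rewrite ler_nat.
  by rewrite (gtn_eqF jm) (gtn_eqF (ltnW jm)) subrr mulr0 addr0.
rewrite /staircase -/j s2 ei im -/s.
have [jE|jE] := divn2_eq im.
  rewrite jE eqxx (ltn_eqF (ltnSn _)).
  rewrite -mul2n natrM subr0 mulr1.
  have f0 : 0 <= s - m%:R by lra.
  have f1 : s - m%:R <= 1 by lra.
  rewrite (min_l f1) (max_r f0) max_r; last by rewrite le_min; apply/andP; split; lra.
  by have [h|h] := leP (s - m%:R) (1 - (s - m%:R)); [rewrite min_l|rewrite min_r]; lra.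
rewrite jE eqxx (gtn_eqF (ltnSn _)).
rewrite -[m.*2.+1%:R]natr1 -mul2n natrM sub0r mulrN1.
have f0 : 0 <= s - m%:R by lra.
have f1 : s - m%:R <= 1 by lra.
rewrite (min_l f1) (max_r f0) min_l; last by lra.
by have [h|h] := leP (s - m%:R) (1 - (s - m%:R)); [rewrite max_l|rewrite max_r]; lra.
Qed.

(** Indicator and average differ only on the level-k interval containing b, which is the support of
    a Haar function of order k + 1, and there both lie in [0, 1]. *)
Lemma staircase_error (R : realType) (k : nat) (b : R) : 0 <= b <= 1 ->
  exists I, [/\ haar_valid R I, I.2 + 1 = k.+1%:Z &
    forall x, 0 <= x < 1 -> `|(x < b)%R%:R - staircase k b x| <= `|haar1 I x|].
Proof.
move=> /andP[b0 b1]; have p n : (0 : R) < 2 ^+ n by apply: exprn_gt0.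
have [b_lt1|b_ge1] := ltP b 1; last first.
  have -> : b = 1 by apply/eqP; rewrite eq_le b1.
  exists (0%N%:Z, k%:Z); split => //.
  - by apply/haar_validP; right; exists 0%N, k; rewrite expn_gt0.
  - by rewrite /=; lia.
  - move=> x x01; have h := truncn_exp2_lt k x01; have /andP[_ ->] := x01.
    have -> : staircase k 1 x = 1 by apply: staircase_ge; rewrite mulr1 -[leRHS]natrX ler_nat.
    by rewrite subrr normr0.
set s := 2 ^+ k * b; have s0 : 0 <= s by rewrite mulr_ge0 // ltW.
have /andP[ms sm] := truncn_itv s0; set m := Num.truncn s in ms sm.
have mk : (m < 2 ^ k)%N by apply: truncn_exp2_lt; rewrite b0.
have sm1 : s < m%:R + 1 by rewrite natr1.
exists (m%:Z, k%:Z); split.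
- by apply/haar_validP; right; exists m, k.
- by rewrite /=; lia.
move=> x x01; have x0 : 0 <= x by case/andP: x01.
have ei := truncn_exp2_div (leqnSn k) x0; rewrite subSnn expn1 in ei.
have xs0 : 0 <= 2 ^+ k * x by rewrite mulr_ge0 // ltW.
have /andP[ix xi] := truncn_itv xs0.
have xb : (x < b) = (2 ^+ k * x < s) by rewrite ltr_pM2l.
have [im|mi|im] := ltngtP (Num.truncn (2 ^+ k * x)) m.
- have h : (Num.truncn (2 ^+ k * x)).+1%:R <= s by apply: le_trans ms; rewrite ler_nat.
  by rewrite xb (lt_le_trans xi h) staircase_ge // subrr normr0.
- have h : s <= (Num.truncn (2 ^+ k * x))%:R by apply: le_trans (ltW sm) _; rewrite ler_nat.
  by rewrite xb ltNge (le_trans h ix) staircase_le // subrr normr0.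
have -> : `|haar1 (m%:Z, k%:Z) x| = 1.
  rewrite haar1_nat // x01; set j := Num.truncn (2 ^+ k.+1 * x) in ei *.
  have [jE|jE] : j = m.*2 \/ j = m.*2.+1 by apply: divn2_eq; rewrite -ei.
    by rewrite jE eqxx ltn_eqF // subr0 normr1.
  by rewrite jE eqxx gtn_eqF // sub0r normrN1.
have /andP[h1 h2] := staircase_bounds k b x.
by rewrite ler_norml; case: (x < b); rewrite /= ?mulr1n ?mulr0n;
  apply/andP; split; lra.
Qed.

(** Telescopes [staircase_step] from level 0, where the average on [0, 1) is [b] itself. *)
Lemma staircase_expansion (R : realType) (h : nat) (b : R) : 0 <= b <= 1 ->
  exists (c : nat -> R) (I : nat -> int * int),
  [/\ forall k, haar_valid R (I k), forall k, (I k).2 + 1 = k%:Z,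
      c 0%N = b, forall k, (0 < k)%N -> 0 <= c k <= 1 / 2 &
      forall x, 0 <= x < 1 ->
        staircase h b x = \sum_(k < h.+1) c k * haar1 (I k) x].
Proof.
move=> b01.
have /choice[f hf] : forall k, exists cI : R * (int * int),
    [/\ haar_valid R cI.2, cI.2.2 + 1 = k.+1%:Z, 0 <= cI.1 <= 1 / 2 &
    forall x, 0 <= x < 1 ->
      staircase k.+1 b x = staircase k b x + cI.1 * haar1 cI.2 x].
  by move=> k; have [c [I hI]] := staircase_step k b01; exists (c, I).
exists (fun k => if k is k'.+1 then (f k').1 else b).
exists (fun k => if k is k'.+1 then (f k').2 else (0, - 1%:Z)); split.
- by case=> [|k]; [apply/haar_validP; left | case: (hf k)].
- by case=> [|k] //; case: (hf k).
- by [].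
- by case=> // k _; case: (hf k).
- move=> x x01; elim: h => [|h IH].
    by rewrite big_ord1 haar1_const x01 mulr1 staircase0.
  by rewrite big_ord_recr /= -IH; have [_ _ _ ->] := hf h.
Qed.

(** The expansion for [0, b) minus that for [0, a); the Boolean tells which endpoint a term comes
    from. The bounds 0 and 1 on the sum serve the later comparison of products by
    [norm_prod_sub]. *)
Lemma interval_expansion (R : realType) (h : nat) (a b : R) :
  0 <= a -> a < b -> b <= 1 ->
  exists (c : 'I_h.+1 * bool -> R) (I : 'I_h.+1 * bool -> int * int)
    (J J' : int * int),
  [/\ forall k, haar_valid R (I k) /\ (I k).2 + 1 = k.1%:Z,
      \sum_k `|c k| <= h.+1%:R,
      \sum_k (if k.1 == ord0 then c k else 0) = b - a,
      [/\ haar_valid R J, haar_valid R J', J.2 + 1 = h.+1%:Z & J'.2 + 1 = h.+1%:Z] &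
      forall x, 0 <= x < 1 ->
        0 <= \sum_k c k * haar1 (I k) x <= 1 /\
        `|(a <= x < b)%R%:R - \sum_k c k * haar1 (I k) x| <=
        `|haar1 J x| + `|haar1 J' x|].
Proof.
move=> a0 ab b1; have b01 : 0 <= b <= 1 by apply/andP; split; lra.
have a01 : 0 <= a <= 1 by apply/andP; split; lra.
have [ca [Ia [va oa ca0 cah ea]]] := staircase_expansion h a01.
have [cb [Ib [vb ob cb0 cbh eb]]] := staircase_expansion h b01.
have [J [vJ oJ eJ]] := staircase_error h a01.
have [J' [vJ' oJ' eJ']] := staircase_error h b01.
(* The two constant terms are merged into [b - a]. Each level then costs at most 1 in l^1 norm,
   since the other coefficients are at most 1/2. *)
pose c (k : 'I_h.+1 * bool) : R := if k.1 == ord0 then (if k.2 then b - a else 0)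
  else if k.2 then cb k.1 else - ca k.1.
pose I (k : 'I_h.+1 * bool) := if k.2 then Ib k.1 else Ia k.1.
exists c, I, J, J'; split => //.
- by move=> [k []]; rewrite /I /=.
- rewrite -(pair_bigA _ (fun k s => `|c (k, s)|)) /=.
  rewrite -[h.+1 in leRHS]card_ord -sumr_const; apply: ler_sum => k _.
  rewrite big_bool /c /=; case: eqP => [_|/eqP k0].
    by rewrite normr0 addr0 ger0_norm; lra.
  have kpos : (0 < k)%N by rewrite lt0n.
  have := cah k kpos; have := cbh k kpos => /andP[h1 h2] /andP[h3 h4].
  by rewrite normrN !ger0_norm //; lra.
- rewrite -(pair_bigA _ (fun k s => if k == ord0 then c (k, s) else 0)) /=.
  rewrite (bigD1 ord0) //= big_bool /= /c /= addr0 big1 ?addr0 // => k /negbTE k0.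
  by rewrite big1 // => s _; rewrite k0.
move=> x x01.
have -> : \sum_k c k * haar1 (I k) x = staircase h b x - staircase h a x.
  rewrite eb // ea // -sumrB -(pair_bigA _ (fun k s => c (k, s) * haar1 (I (k, s)) x)) /=.
  apply: eq_bigr => k _; rewrite big_bool /c /I /=; case: eqP => [->|_] /=.
    have Ib0 : Ib 0%N = Ia 0%N.
      have /haar_validP[->|[? [? [e _]]]] := vb 0%N; last first.
        by have := ob 0%N; rewrite e /=; lia.
      have /haar_validP[->//|[? [? [e _]]]] := va 0%N.
      by have := oa 0%N; rewrite e /=; lia.
    by rewrite ca0 cb0 Ib0; ring.
  by rewrite mulNr.
have /andP[h1 h2] := staircase_bounds h b x.
have /andP[h3 h4] := staircase_bounds h a x.
have h5 := staircase_homo h x (ltW ab).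
split; first by apply/andP; split; lra.
have -> : (a <= x < b)%R%:R = (x < b)%R%:R - (x < a)%R%:R :> R.
  have [xa|xa] := ltP x a; first by rewrite /= (lt_trans xa ab) subrr.
  by rewrite /= subr0.
have E (p q s t : R) : p - q - (s - t) = - (q - t) + (p - s) by ring.
rewrite E; apply: le_trans (ler_normD _ _) _; rewrite normrN.
by apply: lerD; [exact: eJ | exact: eJ'].
Qed.

(** Replaces one factor at a time; the remaining factors are at most 1. *)
Lemma norm_prod_sub (R : realType) (I : Type) (r : seq I) (f g : I -> R) :
  (forall i, 0 <= f i <= 1) -> (forall i, 0 <= g i <= 1) ->
  `|\prod_(i <- r) f i - \prod_(i <- r) g i| <= \sum_(i <- r) `|f i - g i|.
Proof.
move=> f01 g01; elim: r => [|i r IH]; first by rewrite !big_nil subrr normr0.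
rewrite !big_cons; set F := \prod_(j <- r) f j in IH *; set G := \prod_(j <- r) g j in IH *.
have -> : f i * F - g i * G = (f i - g i) * F + g i * (F - G) by ring.
apply: le_trans (ler_normD _ _) _; rewrite !normrM; apply: lerD.
  rewrite ler_piMr // ger0_norm; last by apply: prodr_ge0 => j _; case/andP: (f01 j).
  by apply: prodr_ile1 => j _.
apply: le_trans IH; rewrite ler_piMl //.
by have /andP[h1 h2] := g01 i; rewrite ger0_norm.
Qed.

Lemma mem_box (R : realType) (d : nat) (a b x : d.-tuple R) :
  (x \in box a b)%:R = \prod_(i < d) (tnth a i <= tnth x i < tnth b i)%R%:R :> R.
Proof.
have [h|h] := boolP (x \in box a b).
  by rewrite big1 // => i _; rewrite (set_mem h i).
have [i hi] : exists i, ~~ (tnth a i <= tnth x i < tnth b i).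
  apply/existsP; rewrite -negb_forall; apply: contra h => /forallP h.
  exact/mem_set.
by rewrite (bigD1 i) //= (negbTE hi) mul0r.
Qed.

(** A product depending on coordinate [i] alone. With J an error function of [interval_expansion],
    its support is the slab in which a face of the box is blurred. *)
Definition const_but (d : nat) (i : 'I_d) (J : int * int) : d.-tuple (int * int) :=
  [tuple if j == i then J else (0, - 1%:Z) | j < d].

Lemma haar_const_but (R : realType) (d : nat) (i : 'I_d) (J : int * int)
    (x : d.-tuple R) : unit_cube R d x ->
  haar (const_but i J) x = haar1 J (tnth x i).
Proof.
move=> x01; rewrite /haar (bigD1 i) //= tnth_mktuple eqxx big1 ?mulr1 // => j ji.
by rewrite tnth_mktuple (negbTE ji) haar1_const x01.
Qed.

(** Coordinates reach h + 1 to accommodate the error functions. [M1] also covers total orders above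
    h, since a product of d factors of order at most h may have order up to d h. *)
Definition balanced (R : realType) (d h : nat) (s : seq (d.-tuple R)) (M1 M2 : R) : Prop :=
  forall I : d.-tuple (int * int), (forall i, haar_valid R (tnth I i)) ->
    (forall i, (tnth I i).2 + 1 <= h.+1%:Z) ->
  [/\ 1 <= haar_order I -> `|pairing s (haar I)| <= M1 &
      h%:Z < haar_order I -> pairing s (fun x => `|haar I x|) <= M2].

(** The box indicator is replaced by the product [G] of the one-dimensional approximations: [E1] is
    the cost of the replacement, [E2] the discrepancy of [G] itself. *)
Lemma box_discrepancy (R : realType) (d h : nat) (s : seq (d.-tuple R)) (M1 M2 : R)
    (a b : d.-tuple R) :
  (forall x, x \in s -> unit_cube R d x) -> balanced h s M1 M2 -> 0 <= M1 ->
  (forall i, 0 <= tnth a i /\ tnth a i < tnth b i /\ tnth b i <= 1) ->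
  `|(count (fun z => z \in box a b) s)%:R
    - (size s)%:R * \prod_(i < d) (tnth b i - tnth a i)| <=
  h.+1%:R ^+ d * M1 + d%:R * (2 * M2).
Proof.
move=> s01 bal M0 ab.
pose K := ('I_h.+1 * bool)%type.
have /choice[c /choice[I /choice[J /choice[J' H]]]] i :
    exists c I J J', [/\ forall k : K, haar_valid R (I k) /\ (I k).2 + 1 = k.1%:Z,
      \sum_k `|c k| <= h.+1%:R,
      \sum_k (if k.1 == ord0 then c k else 0) = tnth b i - tnth a i,
      [/\ haar_valid R J, haar_valid R J', J.2 + 1 = h.+1%:Z & J'.2 + 1 = h.+1%:Z] &
      forall x, 0 <= x < 1 ->
        0 <= \sum_k c k * haar1 (I k) x <= 1 /\
        `|(tnth a i <= x < tnth b i)%R%:R - \sum_k c k * haar1 (I k) x| <=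
        `|haar1 J x| + `|haar1 J' x|].
  by have [h0 [h1 h2]] := ab i; apply: interval_expansion.
pose G (x : d.-tuple R) := \prod_(i < d) \sum_k c i k * haar1 (I i k) (tnth x i).
pose coef (f : {ffun 'I_d -> K}) := \prod_(i < d) c i (f i).
(* The coefficients of the constant function only; they sum to the volume of the box. *)
pose coef0 (f : {ffun 'I_d -> K}) := \prod_(i < d) (if (f i).1 == ord0 then c i (f i) else 0).
pose idx (f : {ffun 'I_d -> K}) : d.-tuple (int * int) := [tuple I i (f i) | i < d].
have vidx f i : haar_valid R (tnth (idx f) i).
  by rewrite tnth_mktuple; have [/(_ (f i))[]] := H i.
have oidx f i : (tnth (idx f) i).2 + 1 = (f i).1%:Z.
  by rewrite tnth_mktuple; have [/(_ (f i))[]] := H i.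
have cidx f i : (tnth (idx f) i).2 + 1 <= h.+1%:Z.
  by rewrite oidx lez_nat ltnW.
have GE x : G x = \sum_f coef f * haar (idx f) x.
  rewrite /G bigA_distr_bigA; apply: eq_bigr => f _.
  rewrite /coef /haar -big_split /=; apply: eq_bigr => i _.
  by rewrite tnth_mktuple.
have -> : (count (fun z => z \in box a b) s)%:R = \sum_(x <- s) (x \in box a b)%:R :> R.
  by rewrite -sum1_count natr_sum [RHS]big_mkcond /= big_mkcond; apply: eq_bigr => x _; case: ifP.
(* Two slabs per coordinate, each of order h + 1, hence above h, and each holding at most [M2]
   points. *)
have E1 : `|\sum_(x <- s) ((x \in box a b)%:R - G x)| <= d%:R * (2 * M2).
  apply: le_trans (ler_norm_sum _ _ _) _.
  apply: (@le_trans _ _ (\sum_(x <- s) \sum_(i < d)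
     (`|haar (const_but i (J i)) x| + `|haar (const_but i (J' i)) x|))).
    rewrite big_seq [leRHS]big_seq; apply: ler_sum => x /s01 x01.
    rewrite mem_box /G; apply: le_trans (norm_prod_sub _ _ _) _.
    - by move=> i; case: (_ <= _ < _); rewrite /= ?ler01 ?lexx.
    - by move=> i; have [_ _ _ _ /(_ _ (x01 i))[]] := H i.
    apply: ler_sum => i _; rewrite !haar_const_but //.
    by have [_ _ _ _ /(_ _ (x01 i))[]] := H i.
  rewrite exchange_big /= -[d in leRHS]card_ord -sumr_const mulr_suml.
  apply: ler_sum => i _; rewrite mul1r big_split /= mulr_natl mulr2n.
  have good j : haar_valid R j -> j.2 + 1 = h.+1%:Z ->
      \sum_(x <- s) `|haar (const_but i j) x| <= M2.
    move=> vj oj; have [||_] := bal (const_but i j).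
    - by move=> l; rewrite tnth_mktuple; case: ifP => // _; apply/haar_validP; left.
    - by move=> l; rewrite tnth_mktuple; case: ifP => // _; rewrite oj.
    apply; rewrite /haar_order (bigD1 i) //= tnth_mktuple eqxx oj big1 ?addr0 ?ltz_nat //.
    by move=> l li; rewrite tnth_mktuple (negbTE li).
  by have [_ _ _ [vJ vJ' oJ oJ'] _] := H i; apply: lerD; apply: good.
have E2 : `|\sum_(x <- s) G x - (size s)%:R * \prod_(i < d) (tnth b i - tnth a i)| <=
    h.+1%:R ^+ d * M1.
  have -> : \prod_(i < d) (tnth b i - tnth a i) = \sum_f coef0 f.
    rewrite /coef0 -(bigA_distr_bigA (fun i k => if k.1 == ord0 then c i k else 0)).
    by apply: eq_bigr => i _; have [_ _ -> _ _] := H i.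
  have -> : \sum_(x <- s) G x = \sum_f coef f * pairing s (haar (idx f)).
    under eq_bigr => x _ do rewrite GE.
    by rewrite exchange_big /=; apply: eq_bigr => f _; rewrite mulr_sumr.
  rewrite mulr_sumr -sumrB.
  apply: (@le_trans _ _ (\sum_f `|coef f| * M1)).
    apply: le_trans (ler_norm_sum _ _ _) _; apply: ler_sum => f _.
    have [f0|] := boolP [forall i, (f i).1 == ord0].
      have -> : coef0 f = coef f.
        by apply: eq_bigr => i _; rewrite (forallP f0 i).
      have -> : pairing s (haar (idx f)) = (size s)%:R.
        rewrite /pairing -sum1_size natr_sum big_seq [RHS]big_seq.
        apply: eq_bigr => x /s01 x01; apply: big1 => i _.
        have := vidx f i; have := oidx f i; rewrite (eqP (forallP f0 i)) /=.
        move=> oi /haar_validP[->|[? [? [e _]]]]; first by rewrite haar1_const x01.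
        by move: oi; rewrite e /=; lia.
      by rewrite mulrC subrr normr0 mulr_ge0.
    rewrite negb_forall => /existsP[i fi].
    have -> : coef0 f = 0 by rewrite /coef0 (bigD1 i) //= (negbTE fi) mul0r.
    rewrite mulr0 subr0 normrM ler_wpM2l //.
    have [h1 _] := bal (idx f) (vidx f) (cidx f); apply: h1.
    rewrite /haar_order (eq_bigr _ (fun i _ => oidx f i)).
    rewrite -(big_morph Posz PoszD (erefl 0%:Z)) lez_nat (bigD1 i) //=.
    by rewrite (leq_trans _ (leq_addr _ _)) // lt0n.
  rewrite -mulr_suml ler_wpM2r //.
  (* The l^1 norm of the product coefficients factors into d norms, each at most h + 1. *)
  rewrite (eq_bigr (fun f : {ffun 'I_d -> K} => \prod_(i < d) `|c i (f i)|)); last first.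
    by move=> f _; rewrite normr_prod.
  rewrite -(bigA_distr_bigA (fun i k => `|c i k|)) /=.
  rewrite -[d in leRHS]card_ord -prodr_const; apply: ler_prod => i _.
  rewrite sumr_ge0 //=; by have [_ ->] := H i.
have -> : \sum_(x <- s) (x \in box a b)%:R = \sum_(x <- s) ((x \in box a b)%:R - G x) +
    \sum_(x <- s) G x by rewrite -big_split /=; apply: eq_bigr => x _; rewrite subrK.
rewrite -addrA addrC; apply: le_trans (ler_normD _ _) _; exact: lerD.
Qed.

Lemma Dis_le (R : realType) (d h : nat) (s : seq (d.-tuple R)) (M1 M2 : R) :
  (forall x, x \in s -> unit_cube R d x) -> balanced h s M1 M2 -> 0 <= M1 ->
  Dis s <= h.+1%:R ^+ d * M1 + d%:R * (2 * M2).
Proof.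
move=> s01 bal M0; apply: ge_sup.
  exists `|(count (fun z => z \in box (nseq_tuple d 0) (nseq_tuple d 1)) s)%:R
    - (size s)%:R * fine (lebesgue_tuple (box (nseq_tuple d (0 : R)) (nseq_tuple d 1)))|.
  exists (nseq_tuple d 0), (nseq_tuple d 1); split => // i.
  by rewrite !tnth_nseq; split; [|split]; rewrite ?ltr01 ?lexx.
move=> _ [a [b [ab ->]]].
rewrite lebesgue_tuple_box => [|i]; last by have [_ [/ltW]] := ab i.
exact: box_discrepancy.
Qed.

(** * Probability of the bad events *)

Definition unbalanced (R : realType) (d L h : nat) (t1 t2 : R)
    (m : {ffun 'I_d -> 'I_(2 ^ L)}) (c : seq {ffun 'I_d -> 'I_(2 ^ L).+1}) : bool :=
  let J := haar_codes m in let s := map (rep R (L := L)) c in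
  (1 <= haar_order J) &&
  if haar_order J <= h%:Z then t1 < `|pairing s (haar J)|
  else t2 < pairing s (fun x => `|haar J x|).

(** [t1] is defined by theta t1 = t2, so both kinds of deviation pass the same threshold exp t2 >=
    2^((h + 1) (d + 3)) in the inequality of Markov. *)
Lemma unbalanced_mass (R : realType) (d n : nat) (beta : R) :
  (0 < d)%N -> 0 < beta <= 1 -> (1 < n)%N ->
  let h := trunc_log 2 n in let L := h.+1 in
  let t2 : R := (L * (d + 3))%:R in
  let t1 := 6 * (haar_W d h)%:R * t2 / beta in
  forall m : {ffun 'I_d -> 'I_(2 ^ L)},
  \sum_(c <- histories {ffun 'I_d -> 'I_(2 ^ L).+1} n | unbalanced h t1 t2 m c)
    history_mass (cell_mass R (L := L)) (cell_density beta) c <=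
  expR (5 * 2 ^+ d) * (2 + n%:R * 2) / 2 ^+ (L * (d + 3)).
Proof.
move=> d0 b01 n1 h L t2 t1 m; have /andP[b0 b1] := b01.
set J := haar_codes m; set K := expR (5 * 2 ^+ d).
have K0 : 0 <= K by exact: expR_ge0.
have p n' : (0 : R) < 2 ^+ n' by apply: exprn_gt0.
have h1 : (0 < h)%N by rewrite trunc_log_gt0.
have vJ i : haar_valid R (tnth J i) by rewrite tnth_mktuple; exact: haar_code_valid.
have nL : (trunc_log 2 n <= L)%N by exact: leqnSn.
have oJ := haar_order_nat vJ; set k := (\sum_(i < d) _)%N in oJ.
have hJ i : (tnth J i).2 + 1 <= L%:Z.
  rewrite tnth_mktuple; case: (m i) => [[|q] hq] //=.
  rewrite -[_ + 1]/(Posz (trunc_log 2 q.+1 + 1)%N) lez_nat addn1.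
  rewrite -(ltn_exp2l _ _ (m := 2)) //.
  by apply: leq_ltn_trans hq; apply: trunc_logP.
have v0 (a : {ffun 'I_d -> 'I_(2 ^ L).+1}) : 0 <= cell_mass R a by exact: cell_mass_ge0.
have l0 c (a : {ffun 'I_d -> 'I_(2 ^ L).+1}) : 0 <= cell_density beta c a.
  have /andP[hb _] := haar_density_bounds (size c).+1
    (map (rep R (L := L)) c) (rep R a) d0 (ltW b0).
  by apply: le_trans hb; lra.
have X0 : 0 <= K * (2 + n%:R * 2) / 2 ^+ (L * (d + 3)).
  by rewrite divr_ge0 ?mulr_ge0 ?addr_ge0 ?mulr_ge0 // ltW.
have tail (M x : R) : 0 <= x -> x <= K * (2 + n%:R * 2) -> expR t2 <= M ->
    x / M <= K * (2 + n%:R * 2) / 2 ^+ (L * (d + 3)).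
  move=> x0 xK tM; have M2 : 2 ^+ (L * (d + 3)) <= M.
    by apply: le_trans tM; exact: expR_nat_ge.
  apply: ler_pM => //; first by rewrite invr_ge0 (le_trans _ M2) // ltW.
  by rewrite lef_pV2 ?posrE // (lt_le_trans (p _) M2).
have [k0|k0] := posnP k.
  by rewrite big_pred0 // => c; rewrite /unbalanced -/J oJ k0.
have [kh|hk] := leqP k h.
  set theta : R := beta / (6 * (haar_W d h)%:R).
  have W0 : (0 : R) < (haar_W d h)%:R by rewrite ltr0n haar_W_gt0.
  have th0 : 0 < theta by rewrite divr_gt0 // mulr_gt0.
  have tt : theta * t1 = t2 by rewrite /theta /t1; field; apply/andP; split; lra.
  apply: le_trans (history_markov (M := expR t2) (Phi := fun c =>
     expR (theta * pairing (map (rep R (L := L)) c) (haar J)) +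
     expR (- (theta * pairing (map (rep R (L := L)) c) (haar J)))) n v0 l0 _ _ _) _.
  - by move=> c; rewrite addr_ge0 ?expR_ge0.
  - exact: expR_gt0.
  - move=> c; rewrite /unbalanced -/J oJ !lez_nat kh k0 /= => hc.
    rewrite -tt; set S := pairing _ _ in hc *.
    have hS : expR (theta * t1) <= expR (theta * `|S|).
      by rewrite ler_expR ler_pM2l // ltW.
    apply: le_trans hS _; have e1 := expR_ge0 (theta * S).
    have e2 := expR_ge0 (- (theta * S)).
    by case: (ger0P S) => _; rewrite ?mulrN; lra.
  apply: tail => //.
    apply: sumr_ge0 => c _; rewrite mulr_ge0 ?addr_ge0 ?expR_ge0 //.
    exact: history_mass_ge0.
  exact: (haar_moment d0 b01 nL vJ hJ oJ k0 kh).
apply: le_trans (history_markov (M := expR t2) (Phi := fun c =>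
   expR (pairing (map (rep R (L := L)) c) (fun x => `|haar J x|))) n v0 l0 _ _ _) _.
- by move=> c; exact: expR_ge0.
- exact: expR_gt0.
- move=> c; rewrite /unbalanced -/J oJ !lez_nat [(k <= h)%N]leqNgt hk /= => /andP[_ hc].
  by rewrite ler_expR ltW.
apply: tail => //.
  apply: sumr_ge0 => c _; rewrite mulr_ge0 ?expR_ge0 //.
  exact: history_mass_ge0.
have nk : (n <= 2 ^ k)%N.
  apply: ltnW; apply: leq_trans (trunc_log_ltn n (isT : 1 < 2)%N) _.
  by rewrite leq_exp2l.
apply: le_trans (count_moment d0 b01 nL vJ hJ oJ nk) _.
rewrite -/K ler_peMr //; have : (0 : R) <= n%:R by []; lra.
Qed.

Lemma bad_event (R : realType) (dT : measure_display)
    (T : measurableType dT) (P : probability T R) (d n : nat) (beta : R)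
    (X : nat -> {RV P >-> d.-tuple (measurableTypeR R)})
    (U : nat -> {RV P >-> measurableTypeR R})
    (chi : nat -> T -> bool) (Z : nat -> T -> d.-tuple R) :
  (0 < d)%N -> 0 < beta <= 1 ->
  (forall m, uniform_on_cube (X m)) -> mutually_independent X ->
  (forall n, uniform_on_itv01 (U n)) -> mutually_independent U ->
  independent_sequences X U ->
  (forall w, thinning (haar_strategy beta)
    (fun m => X m w) (fun n => U n w) (fun n => chi n w) (fun n => Z n w)) ->
  (1 < n)%N ->
  let h := trunc_log 2 n in
  let t2 : R := (h.+1 * (d + 3))%:R in
  let t1 := 6 * (haar_W d h)%:R * t2 / beta in
  exists E : set T, [/\ measurable E,
    (P E <= (2 * expR (5 * 2 ^+ d) / n.+1%:R ^+ 2)%:E)%E &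
    forall w, ~ E w -> balanced h (mkseq (fun i => Z i w) n) (t1 + t2) t2].
Proof.
move=> d0 b01 uX iX uU iU iXU thin n1 h t2 t1; pose L := h.+1.
have /andP[b0 b1] := b01.
have b01' : 0 <= beta <= 1 by rewrite ltW.
pose C := {ffun 'I_d -> 'I_(2 ^ L).+1}.
pose bad (c : seq C) := [exists m : {ffun 'I_d -> 'I_(2 ^ L)}, unbalanced h t1 t2 m c].
(* Lists of other lengths get the empty event, so that the whole family is measurable, as
   [measure_big_setU] demands. *)
pose A (c : seq C) := if size c == n then [set w | mkseq (fun i => cell L (Z i w)) n = c] else set0.
have AP c : measurable (A c) /\
    (P (A c) <= (history_mass (cell_mass R (L := L)) (cell_density beta) c)%:E)%E.
  rewrite /A; case: eqP => [cn|_]; last first.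
    rewrite measure0 lee_fin; split => //; apply: history_mass_ge0.
      by move=> a; exact: cell_mass_ge0.
    move=> s a; have /andP[hb _] := haar_density_bounds (size s).+1
      (map (rep R (L := L)) s) (rep R a) d0 (ltW b0).
    by apply: le_trans hb; lra.
  rewrite -cn; apply: (haar_history_bound d0 b01' uX iX uU iU iXU thin).
  by rewrite cn; exact: leqnSn.
have [mE PE] := measure_big_setU P [seq c <- histories C n | bad c] (fun c => (AP c).1).
exists (\big[setU/set0]_(c <- [seq c <- histories C n | bad c]) A c); split => //.
  apply: le_trans PE _.
  apply: (@le_trans _ _ (\sum_(c <- [seq c <- histories C n | bad c])
     (history_mass (cell_mass R (L := L)) (cell_density beta) c)%:E)%E).
    by apply: lee_sum => c _; exact: (AP c).2.
  rewrite sumEFin lee_fin big_filter.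
  have rho0 (c : seq C) : 0 <= history_mass (cell_mass R (L := L)) (cell_density beta) c.
    by rewrite -lee_fin; apply: le_trans (AP c).2.
  apply: (@le_trans _ _ (\sum_(m : {ffun 'I_d -> 'I_(2 ^ L)})
     \sum_(c <- histories C n | unbalanced h t1 t2 m c)
       history_mass (cell_mass R (L := L)) (cell_density beta) c)).
    under [leRHS]eq_bigr => m _ do rewrite big_mkcond /=.
    rewrite exchange_big /= big_mkcond /=; apply: ler_sum => c _.
    case: ifP => [/existsP[m hm]|_].
      rewrite (bigD1 m) //= hm lerDl; apply: sumr_ge0 => m' _.
      by case: ifP.
    by apply: sumr_ge0 => m _; case: ifP.
  apply: le_trans (ler_sum _ (fun m _ => unbalanced_mass d0 b01 n1 m)) _.
  rewrite sumr_const card_ffun !card_ord -/h -/L.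
  have p n' : (0 : R) < 2 ^+ n' by apply: exprn_gt0.
  have nL : (n < 2 ^ L)%N by exact: trunc_log_ltn.
  have nLR : n.+1%:R <= 2 ^+ L :> R by rewrite -natrX ler_nat.
  have n0 : (0 : R) < n.+1%:R by rewrite ltr0n.
  rewrite -[_ *+ ((2 ^ L) ^ d)]mulr_natl -expnM natrX.
  set K := expR (5 * 2 ^+ d); have K0 : 0 < K by exact: expR_gt0.
  (* Of the d + 3 powers of 2^(h + 1) > n, d pay for the union bound and one for the linear growth
     of the moment; the last two leave the summable (n + 1)^-2. *)
  have -> : 2 ^+ (L * d) * (K * (2 + n%:R * 2) / 2 ^+ (L * (d + 3))) =
      2 * K * (n.+1%:R / 2 ^+ (L * 3)).
    rewrite mulnDr exprD -natr1; field.
    by rewrite !lt0r_neq0.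
  rewrite ler_pM2l ?mulr_gt0 // ler_pdivrMr //.
  rewrite mulrC ler_pdivlMr ?exprn_gt0 //.
  rewrite -[leLHS]/(n.+1%:R ^+ 3) exprM lerXn2r ?nnegrE //; exact: ltW.
move=> w; rewrite -bigcup_seq => wE.
pose c := mkseq (fun i => cell L (Z i w)) n.
have nbad : ~~ bad c.
  apply/negP => cb; apply: wE; exists c => /=.
    by rewrite mem_filter cb mem_histories size_mkseq eqxx.
  by rewrite /A size_mkseq eqxx.
have t20 : 0 <= t2 by rewrite ler0n.
have t10 : 0 <= t1 by rewrite divr_ge0 ?mulr_ge0 // ltW.
move=> I vI hI; have [m eI] := haar_codes_surj vI hI.
move: nbad; rewrite /bad negb_exists => /forallP /(_ m).
rewrite /unbalanced -eI.
have pE (F : R -> R) : pairing (map (rep R (L := L)) c) (fun x => F (haar I x)) =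
    pairing (mkseq (fun i => Z i w) n) (fun x => F (haar I x)).
  rewrite /pairing big_map /c /mkseq !big_map; apply: eq_bigr => i _.
  by rewrite haar_cell.
rewrite (pE id) (pE Num.norm) => hn.
(* Above order h, |S| is at most the number of points in the support, hence at most t2: so [t1 + t2]
   serves every order. *)
have le_norm : `|pairing (mkseq (fun i => Z i w) n) (haar I)| <=
    pairing (mkseq (fun i => Z i w) n) (fun x => `|haar I x|).
  exact: ler_norm_sum.
split => o1; move: hn.
  rewrite o1 /=; case: ifP => _; rewrite -leNgt => hn.
    by apply: le_trans hn _; rewrite lerDl.
  by apply: le_trans le_norm _; apply: le_trans hn _; rewrite lerDr.
rewrite (_ : 1 <= haar_order I = true) /=; last first.
  by apply: le_trans (ltW o1); rewrite lez_nat trunc_log_gt0.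
by rewrite leNgt o1 /= -leNgt.
Qed.

(** * Numerical constants and the passage to the limit *)

Lemma haar_W_le (d h : nat) : (0 < d)%N -> (haar_W d h <= h.+1 ^ d)%N.
Proof.
move=> d0; rewrite -ltnS haar_W_binomial //.
apply: leq_trans (leqnSn _); elim: d {d0} => [|d IH]; first by rewrite bin0.
(* Induction through (d + 1) C(d + 1 + h, d + 1) = (d + 1 + h) C(d + h, d), with d + 1 + h <= (d +
   1) (h + 1). *)
rewrite -(leq_pmul2l (ltn0Sn d)) -mul_bin_diag expnS mulnA addSn /=.
by apply: leq_mul => //; lia.
Qed.

(** Passes from h + 1 to h, which log n dominates: (1 + 1/h)^m <= e^(m/h) <= e^(1/2) <= 2. *)
Lemma exprS_le2 (R : realType) (h m : nat) : (0 < h)%N -> (2 * m <= h)%N ->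
  h.+1%:R ^+ m <= 2 * h%:R ^+ m :> R.
Proof.
move=> h0 mh; have hR : (0 : R) < h%:R by rewrite ltr0n.
have -> : h.+1%:R = h%:R * (1 + h%:R^-1) :> R.
  by rewrite mulrDr mulr1 mulfV ?lt0r_neq0 // natr1.
rewrite exprMn mulrC ler_pM2r ?exprn_gt0 //.
apply: le_trans (expr_1D_le_expR _ _) _; first by rewrite invr_ge0 ltW.
apply: (@le_trans _ _ (expR (1 / 2))).
  rewrite ler_expR mulrC ler_pdivrMr // mul1r ler_pdivlMl //.
  by rewrite -natrM ler_nat.
have x0 := expR_gt0 (1 / 2 : R); have y0 := expR_ge1Dx (- (1 / 2) : R).
have xy : expR (1 / 2 : R) * expR (- (1 / 2)) = 1 by rewrite -expRD subrr expR0.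
nra.
Qed.

(** With x = h + 1, the factor 8 is 6 from [t1], 1 from the [t2] added to it and 1 from 2 d <=
    x^(2d). Replacing x by h doubles it, and 16 (d + 3) <= 100 (d^2 + 1). *)
Lemma discrepancy_numeric (R : realType) (d h : nat) (beta t1 t2 : R) :
  (0 < d)%N -> 0 < beta <= 1 -> (2 * (2 * d + 1) <= h)%N ->
  t2 = (h.+1 * (d + 3))%:R -> t1 = 6 * (haar_W d h)%:R * t2 / beta ->
  h.+1%:R ^+ d * (t1 + t2) + d%:R * (2 * t2) <=
  100 * (d%:R ^+ 2 + 1) / beta * h%:R ^+ (2 * d + 1).
Proof.
move=> d0 /andP[b0 b1] dh t2D t1D.
have h0 : (0 < h)%N by lia.
set x : R := h.+1%:R; have x1 : 1 <= x by rewrite ler1n.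
have xd1 n : 1 <= x ^+ n by rewrite exprn_ege1.
have Wx : (haar_W d h)%:R <= x ^+ d by rewrite -natrX ler_nat haar_W_le.
have t2E : t2 = x * (d%:R + 3) by rewrite t2D natrM natrD.
have D1 : (1 : R) <= d%:R by rewrite ler1n.
have t20 : 0 <= t2 by rewrite t2D ler0n.
have dx : 2 * d%:R <= x ^+ d * x ^+ d.
  apply: (@le_trans _ _ x); first by rewrite /x -natrM ler_nat; lia.
  case: d d0 {dh t1D t2D Wx t2E D1} => // d _; rewrite [x ^+ d.+1]exprS -mulrA ler_peMr ?mulr_ege1 //.
have step : h.+1%:R ^+ d * (t1 + t2) + d%:R * (2 * t2) <=
    8 * (d%:R + 3) / beta * x ^+ (2 * d + 1).
  have -> : 8 * (d%:R + 3) / beta * x ^+ (2 * d + 1) = 8 * (x ^+ d * x ^+ d) * t2 / beta.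
    by rewrite t2E addn1 exprSr mulnC exprM expr2; ring.
  rewrite ler_pdivlMr // -/x.
  have -> : (x ^+ d * (t1 + t2) + d%:R * (2 * t2)) * beta =
     (6 * x ^+ d * (haar_W d h)%:R + (x ^+ d + 2 * d%:R) * beta) * t2.
    by rewrite t1D; field; exact: lt0r_neq0.
  apply: ler_wpM2r => //.
  have y1 := xd1 d; set y := x ^+ d in y1 Wx dx *.
  have e1 : y * (haar_W d h)%:R <= y * y by apply: ler_wpM2l => //; lra.
  have e2 : y <= y * y by rewrite ler_peMl // (le_trans ler01).
  have e3 : (y + 2 * d%:R) * beta <= y + 2 * d%:R by rewrite ler_piMr //; lra.
  lra.
apply: le_trans step _.
have p := @exprS_le2 R h (2 * d + 1) h0 dh; rewrite -/x in p.
set z := h%:R ^+ (2 * d + 1) in p *.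
have z0 : 0 <= z by rewrite exprn_ge0.
have bi0 : 0 < beta^-1 by rewrite invr_gt0.
apply: (@le_trans _ _ (8 * (d%:R + 3) / beta * (2 * z))).
  by apply: ler_wpM2l => //; rewrite mulr_ge0 ?(ltW bi0) // mulr_ge0 // addr_ge0.
have e : 16 * (d%:R + 3) <= 100 * (d%:R ^+ 2 + 1) :> R.
  have : d%:R <= d%:R ^+ 2 :> R by rewrite expr2 ler_peMl.
  lra.
have -> : 8 * (d%:R + 3) / beta * (2 * z) = 16 * (d%:R + 3) * (beta^-1 * z) by ring.
by rewrite -[leRHS]mulrA; apply: ler_wpM2r => //; rewrite mulr_ge0 // ltW.
Qed.

Lemma measurable_unit_cube (R : realType) (d : nat) :
  measurable (unit_cube R d : set (d.-tuple (measurableTypeR R))).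
Proof.
pose itv01 : set (measurableTypeR R) := `[0, 1[%classic.
have m01 : measurable itv01 by exact: measurable_itv.
rewrite (_ : unit_cube R d = \bigcap_(i in [set: 'I_d])
   ((@tnth d (measurableTypeR R))^~ i @^-1` itv01)).
  apply: fin_bigcap_measurable; first exact: finite_finset.
  by move=> i _; rewrite -[X in measurable X]setTI; apply: measurable_tnth.
apply/seteqP; split => x hx; first by move=> i _; rewrite /itv01 /= in_itv; exact: hx.
by move=> i; have := hx i I; rewrite /itv01 /= in_itv.
Qed.

Lemma log2_ge (R : realType) (n : nat) : (0 < n)%N ->
  (trunc_log 2 n)%:R <= log2 (n%:R : R).
Proof.
move=> n0; have l2 : (0 : R) < ln 2 by rewrite ln_gt0 // ltr1n.
rewrite /log2 ler_pdivlMr // mulr_natl -lnXn // ler_ln ?posrE ?exprn_gt0 ?ltr0n //.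
by rewrite -natrX ler_nat trunc_logP.
Qed.

Lemma sum_inv_sqr (R : realType) (n : nat) :
  \sum_(0 <= i < n) (i.+1%:R ^+ 2)^-1 <= 2 :> R.
Proof.
(* The stronger bound is inductive because 1/(x + 1)^2 <= 1/x - 1/(x + 1). *)
suff h : forall n, \sum_(0 <= i < n.+1) (i.+1%:R ^+ 2)^-1 <= 2 - n.+1%:R^-1 :> R.
  case: n => [|n]; first by rewrite big_geq.
  by apply: le_trans (h n) _; rewrite gerBl invr_ge0.
elim=> [|m IH]; first by rewrite big_nat1 expr1n invr1; lra.
rewrite big_nat_recr //=; apply: le_trans (lerD IH (lexx _)) _.
set x : R := m.+1%:R; have x0 : 0 < x by rewrite ltr0n.
have -> : m.+2%:R = x + 1 :> R by rewrite natr1.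
have sub_le (u v w : R) : w <= u - v -> 2 - u + w <= 2 - v by lra.
apply: sub_le.
have -> : x^-1 - (x + 1)^-1 = (x * (x + 1))^-1.
  by field; apply/andP; split; lra.
rewrite lef_pV2 ?posrE ?exprn_gt0 ?mulr_gt0 ?addr_gt0 //.
by rewrite expr2 ler_pM2r ?addr_gt0 //; lra.
Qed.

Lemma borel_cantelli_inv_sqr (dT : measure_display) (T : measurableType dT)
    (R : realType) (P : probability T R) (E : nat -> set T) (K : R) : 0 <= K ->
  (forall n, measurable (E n)) ->
  (forall n, (P (E n) <= (K / n.+1%:R ^+ 2)%:E)%E) ->
  P.-negligible (lim_sup_set E).
Proof.
move=> K0 mE PE; exists (lim_sup_set E); split => //.
  apply: bigcap_measurableType => n _.
  by apply: bigcup_measurable => k _.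
apply: lim_sup_set_cvg0 => //.
apply: (@le_lt_trans _ _ (K * 2)%:E); last exact: ltry.
apply: lime_le; first exact: is_cvg_nneseries.
apply: nearW => n.
apply: (@le_trans _ _ (\sum_(0 <= i < n) (K / i.+1%:R ^+ 2)%:E)%E).
  by apply: lee_sum => i _; exact: PE.
by rewrite sumEFin lee_fin -mulr_sumr ler_wpM2l // sum_inv_sqr.
Qed.

Lemma limn_esup_le_near (R : realType) (u : nat -> \bar R) (l : \bar R) (N : nat) :
  (forall n, (N <= n)%N -> (u n <= l)%E) -> (limn_esup u <= l)%E.
Proof.
move=> ul; apply: (@le_trans _ _ (ereal_sup (u @` [set n | (N <= n)%N]))).
  apply: ereal_inf_lbound; exists [set n | (N <= n)%N] => //.
  by exists N.
by apply: ge_ereal_sup => _ [n Nn <-]; exact: ul.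
Qed.

Theorem theorem1 (R : realType) (dT : measure_display) (T : measurableType dT)
  (P : probability T R) (d : nat) (beta : R)
  (X : nat -> {RV P >-> d.-tuple (measurableTypeR R)})
  (U : nat -> {RV P >-> measurableTypeR R})
  (chi : nat -> T -> bool) (Z : nat -> T -> d.-tuple R) :
  (1 <= d)%N ->
  0 < beta <= 1 ->
  (forall m, uniform_on_cube (X m)) ->
  mutually_independent X ->
  (forall n, uniform_on_itv01 (U n)) ->
  mutually_independent U ->
  independent_sequences X U ->
  (forall w, thinning (haar_strategy beta)
    (fun m => X m w) (fun n => U n w) (fun n => chi n w) (fun n => Z n w)) ->
  {ae P, forall w,
    (limn_esup (fun n : nat =>
       (Dis (mkseq (fun i => Z i w) n) / log2 n%:R ^+ (2 * d + 1))%:E)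
     <= (100 * (d%:R ^+ 2 + 1) / beta)%:E)%E}.
Proof.
move=> d0 b01 uX iX uU iU iXU thin; have /andP[b0 b1] := b01.
pose t2 n : R := ((trunc_log 2 n).+1 * (d + 3))%:R.
pose t1 n : R := 6 * (haar_W d (trunc_log 2 n))%:R * t2 n / beta.
pose K : R := 2 * expR (5 * 2 ^+ d).
have K0 : 0 <= K by rewrite mulr_ge0 // expR_ge0.
have /choice[E HE] n : exists E : set T, [/\ measurable E,
    (P E <= (K / n.+1%:R ^+ 2)%:E)%E &
    (1 < n)%N -> forall w, ~ E w ->
      balanced (trunc_log 2 n) (mkseq (fun i => Z i w) n) (t1 n + t2 n) (t2 n)].
  have [n1|n1] := ltnP 1 n; last first.
    (* For n at most 1 the empty event completes the sequence to which the Borel-Cantelli lemma is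
       applied. *)
    exists set0; split => //; first by rewrite measure0 lee_fin divr_ge0 // exprn_ge0.
  have [E [mE PE hE]] := bad_event d0 b01 uX iX uU iU iXU thin n1.
  by exists E.
have nE : P.-negligible (lim_sup_set E).
  apply: (borel_cantelli_inv_sqr K0) => n; first by case: (HE n).
  by case: (HE n).
have mcube := @measurable_unit_cube R d.
(* The law of [X m] puts the candidates in the cube only almost surely; outside this null set every
   point [Z n], being one of the candidates, lies in the cube. *)
have nX : P.-negligible (\bigcup_m (X m @^-1` (~` unit_cube R d))).
  apply: negligible_bigcup => m; exists (X m @^-1` (~` unit_cube R d)); split => //.
    by apply: measurable_funPTI; exact: measurableC.
  transitivity (distribution P (X m) (~` unit_cube R d)) => //.
  rewrite (uX m); last exact: measurableC.
  by rewrite setICl lebesgue_tuple0.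
apply: negligibleS (negligibleU nE nX) => w; apply: contra_notP.
move=> /not_orP[wE wX].
have {}wX m : unit_cube R d (X m w).
  by apply: contrapT => h; apply: wX; exists m.
have Zcube n : unit_cube R d (Z n w) by have [_ ->] := thin w n.
have [N HN] : exists N, forall n, (N <= n)%N -> ~ E n w.
  apply: contrapT => hN; apply: wE => n _; apply: contrapT => hn.
  by apply: hN; exists n => k nk Ek; apply: hn; exists k.
(* Beyond this power of 2, h(n) is at least 2 (2 d + 1), the range in which h + 1 may be replaced by
   h at the cost of a factor 2. *)
apply: (@limn_esup_le_near _ _ _ (maxn N (2 ^ (2 * (2 * d + 1))))) => n.
rewrite geq_max => /andP[Nn dn].
have hn : (2 * (2 * d + 1) <= trunc_log 2 n)%N by exact: trunc_log_max.
have n1 : (1 < n)%N.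
  by rewrite (leq_trans _ dn) // -{1}(expn0 2) ltn_exp2l //; lia.
have [_ _ /(_ n1 w (HN n Nn)) bal] := HE n.
set h := trunc_log 2 n in hn bal *.
have h0 : (0 : R) < h%:R by rewrite ltr0n; lia.
have hl : h%:R <= log2 (n%:R : R) by apply: log2_ge; exact: ltnW.
have l0 : 0 < log2 (n%:R : R) by apply: lt_le_trans hl.
rewrite lee_fin ler_pdivrMr ?exprn_gt0 //.
have t20 : 0 <= t2 n by rewrite ler0n.
have t10 : 0 <= t1 n by rewrite divr_ge0 ?mulr_ge0 // ltW.
apply: le_trans (Dis_le _ bal (addr_ge0 t10 t20)) _.
  by move=> x /mapP[i _ ->].
apply: le_trans (discrepancy_numeric d0 b01 hn erefl erefl) _.
apply: ler_wpM2l; first by rewrite divr_ge0 ?mulr_ge0 ?addr_ge0 ?exprn_ge0 // ltW.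
by rewrite lerXn2r ?nnegrE // ltW.
Qed.
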